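(* Let $\gamma>0$, let $\Omega\subset\mathbb{R}^2$ be a bounded domain with piecewise smooth boundary having exactly one nonconvex corner, placed at the origin, with opening angle $\omega_c\in(\pi,2\pi)$, and let $\widehat\Omega=F_\gamma^{-1}(\Omega)\subset[-1,1]^2$. With the form $\hat A_h$, norm $|||\cdot|||_h$ and finite element space $\widehat V_h$ defined in the context, the following hold with constants independent of the mesh parameter $h\in(0,h_0]$ and of the functions involved. (Continuity) For every $\epsilon>0$ there is a constant $C$ such that $$\hat A_h(\hat v,\hat w)\le C\,|||\hat v|||_h\,|||\hat w|||_h\qquad\text{for all }\hat v,\hat w\in H^{3/2+\epsilon}(\widehat\Omega)+\widehat V_h.$$ (Coercivity) For all $\beta>0$ large enough there is a constant $C$ such that $$|||\hat v|||_h^2\le C\,\hat A_h(\hat v,\hat v)\qquad\text{for all }\hat v\in\widehat V_h.$$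
   Context: **Map.** $F_\gamma:\mathbb{R}^2\to\mathbb{R}^2$ maps the point with polar coordinates $(\hat r,\hat\theta)$ to the point with polar coordinates $(\hat r^\gamma,\hat\theta)$. $\hat\nabla$ and $\hat D^j$ denote the gradient and total derivative of order $j$ in reference coordinates on $\widehat\Omega$; $\hat n$ is the outward unit normal to $\partial\widehat\Omega$. **Mesh and spaces.** $\widehat{\mathcal K}_{h,0}$ is a quasi-uniform mesh on $[-1,1]^2$ of shape regular elements with mesh parameter $h\in(0,h_0]$; the active mesh is $\widehat{\mathcal K}_h=\{K\in\widehat{\mathcal K}_{h,0}:K\cap\widehat\Omega\ne\emptyset\}$. $\widehat{\mathcal F}_h$ is the set of interior faces of $\widehat{\mathcal K}_h$ adjacent to at least one element $K\in\widehat{\mathcal K}_h$ with $\overline K\cap\partial\widehat\Omega\neq\emptyset$. $\widehat V_{h,0}$ is a space of continuous piecewise polynomials of order $p\geq 1$ on $\widehat{\mathcal K}_{h,0}$, and $\widehat V_h$ is its restriction to the active mesh. **Interpolation.** Let $\widehat U$ be a neighborhood of $\widehat\Omega$ containing the active meshes for all $h\in(0,h_0]$. Functions in $H^s(\widehat\Omega)$ are identified with their extensions to $\widehat U$ by a bounded linear extension operator $H^s(\widehat\Omega)\to H^s(\widehat U)$. $\hat\pi_h:H^1(\widehat U)\to\widehat V_h$ is a (linear) Scott–Zhang type interpolation operator, which is a projection: $\hat\pi_h\hat v=\hat v$ for $\hat v\in\widehat V_h$; it acts correspondingly on sums of extended functions and elements of $\widehat V_h$. **Forms.** Put $B=S_{\hat\theta}^TD_\gamma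 S_{\hat\theta}$ with $D_\gamma=\mathrm{diag}(\gamma^{-1},\gamma)$ and $S_{\hat\theta}=\begin{pmatrix}\cos\hat\theta&\sin\hat\theta\\-\sin\hat\theta&\cos\hat\theta\end{pmatrix}$. With $L^2$ inner products $(\cdot,\cdot)$ on the indicated sets, $[\cdot]$ the jump across a face, and fixed parameters $\beta,\tau>0$, $$\hat a_h(\hat v,\hat w)=(\hat\nabla\hat v,B\hat\nabla\hat w)_{\widehat\Omega}-(\hat n\cdot B\hat\nabla\hat v,\hat w)_{\partial\widehat\Omega}+(\hat v,\beta h^{-1}\hat w-\hat n\cdot B\hat\nabla\hat w)_{\partial\widehat\Omega},$$ $$\hat s_h(\hat v,\hat w)=\sum_{j=1}^p\tau h^{2j-1}([\hat D^j\hat v],[\hat D^j\hat w])_{\widehat{\mathcal F}_h},$$ $$\hat A_h(\hat v,\hat w)=\hat a_h(\hat v,\hat w)+\hat s_h(\hat\pi_h\hat v,\hat\pi_h\hat w).$$ The stabilization form satisfies the inverse inequality $\|h^{1/2}\hat\nabla\hat v\|^2_{\partial\widehat\Omega}\le c_I\big(\|\hat\nabla\hat v\|^2_{\widehat\Omega}+\hat s_h(\hat v,\hat v)\big)$ for all $\hat v\in\widehat V_h$, with $c_I$ independent of $h$. **Energy norm.** $$|||\hat v|||_h^2=\|\hat\nabla\hat v\|_{\widehat\Omega}^2+\|h^{1/2}\hat\nabla\hat v\|_{\partial\widehat\Omega}^2+\|h^{-1/2}\hat v\|_{\partial\widehat\Omega}^2+\hat s_h(\hat\pi_h\hat v,\hat\pi_h\hat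 v).$$ *)

(* Defs.v *)
(* Points and vectors of the plane are pairs in R * R. *)
From HB Require Import structures.
From mathcomp Require Import all_boot all_order all_algebra all_fingroup.
From mathcomp Require Import all_classical all_reals all_analysis.

Set Implicit Arguments.
Unset Strict Implicit.
Unset Printing Implicit Defensive.

Import Order.TTheory GRing.Theory Num.Theory.
Import numFieldNormedType.Exports.

Local Open Scope classical_set_scope.
Local Open Scope ring_scope.

Section Plane.
Variable R : realType.
Implicit Types (x y a b : R * R) (t : R).

Definition dot x y : R := x.1 * y.1 + x.2 * y.2.
Definition cross x y : R := x.1 * y.2 - x.2 * y.1.
(* the library norm of R * R is the maximum norm *)
Definition enorm x : R := Num.sqrt (dot x x).
Definition scale t x : R * R := (t * x.1, t * x.2).
Definition rotate t x : R * R :=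
  (cos t * x.1 - sin t * x.2, sin t * x.1 + cos t * x.2).

Definition segpt a b t : R * R := a + scale t (b - a).
Definition segment a b : set (R * R) := [set segpt a b t | t in `[0, 1]].
Definition square : set (R * R) := `[-1, 1] `*` `[-1, 1].

Definition leb2 : set (R * R) -> \bar R :=
  (@lebesgue_measure R \x @lebesgue_measure R)%E.

(* (r, theta) |-> (r `^ gamma, theta) in polar coordinates; for gamma > 0 it is
   a bijection of the plane with inverse Fmap gamma^-1. *)
Definition Fmap (gamma : R) x : R * R :=
  scale (enorm x `^ gamma / enorm x) x.

(* (cos theta, sin theta) = (x.1 / |x|, x.2 / |x|); the value at the origin,
   where theta is undefined, never matters because {0} is negligible. *)
Definition Smap x (u : R * R) : R * R :=
  let c := x.1 / enorm x in let s := x.2 / enorm x in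
  (c * u.1 + s * u.2, - s * u.1 + c * u.2).
Definition Smap_tr x (u : R * R) : R * R :=
  let c := x.1 / enorm x in let s := x.2 / enorm x in
  (c * u.1 - s * u.2, s * u.1 + c * u.2).
Definition Dmap (gamma : R) (u : R * R) : R * R :=
  (gamma^-1 * u.1, gamma * u.2).
Definition Bmap gamma x (u : R * R) : R * R :=
  Smap_tr x (Dmap gamma (Smap x u)).

End Plane.

Section Sobolev.
Variable R : realType.
Implicit Types (D : set (R * R)) (f g v : R * R -> R) (i j : nat) (s : R).

(* classical partial derivative, in the second variable when b = true *)
Definition partial (b : bool) f : R * R -> R := fun x =>
  if b then derive1 (fun t : R => f (x.1, t)) x.2
  else derive1 (fun t : R => f (t, x.2)) x.1.

Definition smooth2 f : Prop := forall w : seq bool,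
  let g := foldr partial f w in
  continuous g /\
  forall x, derivable (fun t : R => g (t, x.2)) x.1 1 /\
            derivable (fun t : R => g (x.1, t)) x.2 1.

Definition test_function D f : Prop :=
  smooth2 f /\
  exists2 K, compact K /\ K `<=` D & forall x, ~ K x -> f x = 0.

Definition L2_on D f : Prop :=
  measurable_fun D f /\ (\int[@leb2 R]_(x in D) (f x ^+ 2)%:E < +oo)%E.

(* g is a square integrable weak derivative d_1^i d_2^j v on D *)
Definition is_wder D i j v g : Prop :=
  [/\ L2_on D v, L2_on D g &
    forall phi, test_function D phi ->
      \int[@leb2 R]_(x in D)
         (v x * iter j (partial true) (iter i (partial false) phi) x)
      = (-1) ^+ (i + j) * \int[@leb2 R]_(x in D) (g x * phi x)].

(* a representative of the weak derivative, 0 if there is none *)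
Definition wder D i j v : R * R -> R :=
  xget (fun=> 0) [set g | is_wder D i j v g].

Definition wgrad D v (x : R * R) : R * R := (wder D 1 0 v x, wder D 0 1 v x).

(* squared norm of H^s(D), with the Sobolev-Slobodeckij seminorm of the
   derivatives of order floor(s) when s is not an integer *)
Definition slobodeckij D (sigma : R) g : \bar R :=
  (\int[@leb2 R]_(x in D) \int[@leb2 R]_(y in D)
     (((g x - g y) ^+ 2) / (enorm (x - y) `^ (2 + 2 * sigma)))%:E)%E.

Definition Hnorm2 D s v : \bar R :=
  let k := Num.truncn s in let sigma := s - k%:R in
  (\sum_(0 <= n < k.+1) \sum_(0 <= i < n.+1)
      \int[@leb2 R]_(x in D) (wder D i (n - i) v x ^+ 2)%:E
   + (if sigma == 0%R then 0
      else \sum_(0 <= i < k.+1) slobodeckij D sigma (wder D i (k - i) v)))%E.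

Definition Hs D s : set (R * R -> R) := [set v |
  (forall i j, (i + j <= Num.truncn s)%N -> exists g, is_wder D i j v g) /\
  (Hnorm2 D s v < +oo)%E].

Definition bounded_extension D U s
    (E : (R * R -> R) -> (R * R -> R)) : Prop :=
  [/\ forall v, Hs D s v ->
        Hs U s (E v) /\ {ae @leb2 R, forall x, D x -> E v x = v x},
      forall (a : R) v w, Hs D s v -> Hs D s w ->
        {ae @leb2 R, forall x, U x ->
           E (fun y => a * v y + w y) x = a * E v x + E w x}
    & exists C : R, forall v, Hs D s v ->
        (Hnorm2 U s (E v) <= C%:E * Hnorm2 D s v)%E].

(* Trace at x of a function defined a.e. in D, as the limit of its means over
   D `&` B(x, 1 / (n + 1)).  It depends only on the class of f a.e. in D. *)
Definition trace D f (x : R * R) : R :=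
  let B n := D `&` [set y | enorm (y - x) < n.+1%:R^-1] in
  lim ((\int[@leb2 R]_(y in B n) f y / fine (leb2 (B n)))
         @[n --> \oo]).

Definition gtrace D v (x : R * R) : R * R :=
  (trace D (wder D 1 0 v) x, trace D (wder D 0 1 v) x).

End Sobolev.

Section PolygonalMesh.
Variable R : realType.
Implicit Types (K L : seq (R * R)) (T : seq (seq (R * R))).

(* An element is given by its vertices, listed counterclockwise. *)
Definition edges K : seq ((R * R) * (R * R)) := zip K (rot 1 K).

Definition convex_polygon K : Prop :=
  [/\ (2 < size K)%N, uniq K &
    forall e c, e \in edges K -> c \in K -> c != e.1 -> c != e.2 ->
      0 < cross (e.2 - e.1) (c - e.1)].

Definition elt K : set (R * R) :=
  [set x | forall e, e \in edges K -> 0 <= cross (e.2 - e.1) (x - e.1)].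

Definition is_mesh T : Prop :=
  [/\ uniq T,
      forall K, K \in T -> convex_polygon K,
      [set x | exists2 K, K \in T & elt K x] = @square R
    & forall K L, K \in T -> L \in T -> K <> L ->
        [\/ elt K `&` elt L = set0,
            exists a, [/\ a \in K, a \in L & elt K `&` elt L = [set a]]
          | exists e, [/\ e \in edges K, (e.2, e.1) \in edges L &
              elt K `&` elt L = segment e.1 e.2]]].

Definition quasi_uniform (h0 : R) (T : R -> seq (seq (R * R))) : Prop :=
  exists c C : R, [/\ 0 < c, 0 < C &
    forall h K, 0 < h <= h0 -> K \in T h ->
      [/\ exists x, forall y, enorm (y - x) <= c * h -> elt K y,
          forall x y, elt K x -> elt K y -> enorm (x - y) <= C * h
        & forall e, e \in edges K -> c * h <= enorm (e.2 - e.1)]].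

(* Bivariate polynomials: the outer variable is the second coordinate. *)
Definition peval (q : {poly {poly R}}) (x : R * R) : R := q.[x.2%:P].[x.1].

Definition pder (b : bool) (q : {poly {poly R}}) : {poly {poly R}} :=
  if b then q^`() else map_poly (fun r : {poly R} => r^`()) q.

(* degree at most p in each variable; see fe_space *)
Definition order_le (p : nat) (q : {poly {poly R}}) : Prop :=
  (size q <= p.+1)%N /\ forall i, (size (q`_i)%R <= p.+1)%N.

(* A linear space of continuous piecewise polynomials of order p.  As any
   subspace is allowed, both the spaces of total degree at most p and the
   tensor product spaces of order p are covered. *)
Definition fe_space (p : nat) T (V : set (R * R -> R)) : Prop :=
  [/\ forall v, V v -> {within @square R, continuous v} /\
        forall K, K \in T -> exists2 q, order_le p q &
          forall x, elt K x -> v x = peval q x,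
      V (fun=> 0)
    & forall (a : R) v w, V v -> V w -> V (fun x => a * v x + w x)].

(* the polynomial that represents v on K *)
Definition piece (p : nat) K (v : R * R -> R) : {poly {poly R}} :=
  xget 0 [set q | order_le p q /\ forall x, elt K x -> v x = peval q x].

End PolygonalMesh.

Section Domain.
Variable R : realType.

Definition smooth1 (f : R -> R) : Prop :=
  forall n t, derivable (derive1n n f) t 1.

Definition velocity (c : R -> R * R) (t : R) : R * R :=
  (derive1 (fun s => (c s).1) t, derive1 (fun s => (c s).2) t).

(* w is the angle of a corner of a domain lying to the left of its boundary,
   with incoming tangent u and outgoing tangent v *)
Definition corner_angle (u v : R * R) (w : R) : Prop :=
  0 < w < 2 * pi /\ scale (enorm v) (- u) = scale (enorm u) (rotate w v).

(* Bounded domain whose boundary consists of m regular C^oo arcs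
   c i : [0, 1] -> R * R having Om on their left; arc i ends where arc sg i
   starts, and the arcs have no other common points. *)
Definition piecewise_smooth_domain (Om : set (R * R)) (m : nat)
    (c : 'I_m -> R -> R * R) (sg : {perm 'I_m}) : Prop :=
  [/\ open Om, Om !=set0, connected Om &
      exists M : R, forall x, Om x -> enorm x <= M] /\
  [/\ forall i, smooth1 (fun t => (c i t).1) /\ smooth1 (fun t => (c i t).2),
      forall i t, 0 <= t <= 1 -> velocity (c i) t != 0,
      forall i, c i 1 = c (sg i) 0,
      forall i j s t, 0 <= s < 1 -> 0 <= t < 1 -> c i s = c j t ->
        i = j /\ s = t
    & closure Om `\` Om = \bigcup_(i in [set: 'I_m]) (c i @` `[0, 1])] /\
  forall i t, 0 < t < 1 ->
    let nu := rotate (pi / 2) (velocity (c i) t) in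
    \forall s \near (0 : R)^'+,
      Om (c i t + scale s nu) /\ ~ closure Om (c i t - scale s nu).

Definition one_nonconvex_corner (m : nat) (c : 'I_m -> R -> R * R)
    (sg : {perm 'I_m}) (omega_c : R) : Prop :=
  exists w : 'I_m -> R,
    (forall i,
       corner_angle (velocity (c i) 1) (velocity (c (sg i)) 0) (w i)) /\
    exists i0, [/\ c i0 1 = 0, w i0 = omega_c & forall i, i != i0 -> w i <= pi].

End Domain.

(* The data of the method; the assumptions on them are cutfem_setting below. *)
Record cutfem (R : realType) := Cutfem {
  gam : R;
  Omega : set (R * R);
  narcs : nat;
  arc : 'I_narcs -> R -> R * R;
  next_arc : {perm 'I_narcs};
  hmax : R;
  mesh : R -> seq (seq (R * R));
  fe_order : nat;
  fespace0 : R -> set (R * R -> R);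
  stab : R;
  nbhd : set (R * R);
  extend : R -> (R * R -> R) -> (R * R -> R);
  interp : R -> (R * R -> R) -> (R * R -> R)
}.

Section Method.
Variables (R : realType) (M : cutfem R).
Implicit Types (h beta s : R) (v w : R * R -> R).

Definition refdom : set (R * R) := Fmap (gam M) @^-1` Omega M.
Definition refbd : set (R * R) := closure refdom `\` refdom.
Definition refarc (i : 'I_(narcs M)) (t : R) : R * R :=
  Fmap (gam M)^-1 (arc i t).
Definition speed (i : 'I_(narcs M)) (t : R) : R :=
  enorm (velocity (refarc i) t).
(* the domain is on the left of the arcs *)
Definition onormal (i : 'I_(narcs M)) (t : R) : R * R :=
  scale (speed i t)^-1 (rotate (- (pi / 2)) (velocity (refarc i) t)).

(* integrals over the boundary of refdom of f, a function of the point and of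
   the outward unit normal *)
Definition bint (f : R * R -> R * R -> R) : R :=
  \sum_i \int[@lebesgue_measure R]_(t in `[0, 1])
    (f (refarc i t) (onormal i t) * speed i t).
Definition bint_sq (f : R * R -> R) : \bar R :=
  (\sum_i \int[@lebesgue_measure R]_(t in `[0%R, 1%R])
    (f (refarc i t) * speed i t)%:E)%E.

Definition active_mesh h : seq (seq (R * R)) :=
  [seq K <- mesh M h | `[< elt K `&` refdom !=set0 >]].
Definition active_set h : set (R * R) :=
  [set x | exists2 K, K \in active_mesh h & elt K x].

(* Functions on the active mesh are represented by functions vanishing
   outside of it. *)
Definition Vh h : set (R * R -> R) :=
  [set v \_ (active_set h) | v in fespace0 M h].
(* (extension of H^s) + V_h, as functions on the active mesh *)
Definition Hs_plus_Vh h s : set (R * R -> R) := [set v |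
  exists u phi, [/\ Hs refdom s u, Vh h phi &
    v = (extend M s u \_ (active_set h)) \+ phi]].
Definition interp_dom h : set (R * R -> R) := [set v |
  exists u phi, [/\ Hs (nbhd M) 1 u, Vh h phi &
    v = (u \_ (active_set h)) \+ phi]].

Definition elt_patch h (K : seq (R * R)) : set (R * R) :=
  interior [set x | exists L, [/\ L \in active_mesh h,
    elt L `&` elt K !=set0 & elt L x]].
Definition local_norm2 h (D : set (R * R)) v : \bar R :=
  (\int[@leb2 R]_(x in D) (v x ^+ 2)%:E
   + (h ^+ 2)%:E *
     \int[@leb2 R]_(x in D) (dot (wgrad D v x) (wgrad D v x))%:E)%E.

(* linear projection onto V_h with the local stability of the Scott-Zhang
   operator, uniformly in h *)
Definition scott_zhang_type : Prop :=
  (forall h, 0 < h <= hmax M ->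
     [/\ forall v, interp_dom h v -> Vh h (interp M h v),
         forall (a : R) v w, interp_dom h v -> interp_dom h w ->
           interp M h (fun x => a * v x + w x) =
           (fun x => a * interp M h v x + interp M h w x)
       & forall v, Vh h v -> interp M h v = v]) /\
  exists C : R, forall h K v, 0 < h <= hmax M -> K \in active_mesh h ->
    interp_dom h v ->
    (local_norm2 h (interior (elt K)) (interp M h v)
     <= C%:E * local_norm2 h (elt_patch h K) v)%E.

Definition near_boundary (K : seq (R * R)) : bool :=
  `[< elt K `&` refbd !=set0 >].

(* ([D^j v], [D^j w]) over the face from a to b shared by K and L, for v and w
   in V_h, D^j v being the full tensor of partial derivatives of order j *)
Definition face_form (j : nat) (K L : seq (R * R)) (e : (R * R) * (R * R))
    v w : R :=
  let jump (d : seq bool) u x :=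
    peval (foldr (@pder R) (piece (fe_order M) K u) d) x
    - peval (foldr (@pder R) (piece (fe_order M) L u) d) x in
  \int[@lebesgue_measure R]_(t in `[0, 1])
    ((\sum_(d : j.-tuple bool)
        jump d v (segpt e.1 e.2 t) * jump d w (segpt e.1 e.2 t))
     * enorm (e.2 - e.1)).

(* Sum over the interior faces of the active mesh adjacent to an element that
   meets the boundary; i < k so that each face is counted once. *)
Definition s_h h v w : R :=
  let T := active_mesh h in
  \sum_(1 <= j < (fe_order M).+1) stab M * h ^+ (2 * j - 1) *
    \sum_(i < size T) \sum_(k < size T | (i < k)%N)
      let K := nth [::] T i in let L := nth [::] T k in
      \sum_(e <- edges K | ((e.2, e.1) \in edges L)
                           && (near_boundary K || near_boundary L))
        face_form j K L e v w.

Definition a_h beta h v w : R :=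
  let B := Bmap (gam M) in
  let tr u := trace refdom u in
  let gr u := wgrad refdom u in
  let gtr u := gtrace refdom u in
  \int[@leb2 R]_(x in refdom) dot (gr v x) (B x (gr w x))
  - bint (fun x n => dot n (B x (gtr v x)) * tr w x)
  + bint (fun x n =>
      tr v x * (beta * h^-1 * tr w x - dot n (B x (gtr w x)))).

Definition A_h beta h v w : R :=
  a_h beta h v w + s_h h (interp M h v) (interp M h w).

Definition grad_norm2 v : \bar R :=
  (\int[@leb2 R]_(x in refdom) (dot (wgrad refdom v x) (wgrad refdom v x))%:E)%E.
Definition bd_grad_norm2 v : \bar R :=
  bint_sq (fun x => dot (gtrace refdom v x) (gtrace refdom v x)).

(* Norms are extended real numbers, so that a divergent integral is not read
   as 0. *)
Definition energy2 h v : \bar R :=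
  (grad_norm2 v + h%:E * bd_grad_norm2 v
   + (h^-1)%:E * bint_sq (fun x => (trace refdom v x ^+ 2)%R)
   + (s_h h (interp M h v) (interp M h v))%:E)%E.
Definition energy h v : \bar R := sqrte (energy2 h v).

Definition inverse_inequality : Prop :=
  exists2 c_I : R, 0 < c_I & forall h v, 0 < h <= hmax M -> Vh h v ->
    (h%:E * bd_grad_norm2 v <= c_I%:E * (grad_norm2 v + (s_h h v v)%:E))%E.

Record cutfem_setting (omega_c : R) : Prop := {
  gam_gt0 : 0 < gam M;
  omega_c_bounds : pi < omega_c < 2 * pi;
  Omega_smooth : piecewise_smooth_domain (Omega M) (@arc R M) (next_arc M);
  Omega_corner : one_nonconvex_corner (@arc R M) (next_arc M) omega_c;
  refdom_square : refdom `<=` @square R;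
  hmax_gt0 : 0 < hmax M;
  mesh_is_mesh : forall h, 0 < h <= hmax M -> is_mesh (mesh M h);
  mesh_quasi_uniform : quasi_uniform (hmax M) (mesh M);
  fe_order_ge1 : (1 <= fe_order M)%N;
  fespace0_fe : forall h, 0 < h <= hmax M ->
    fe_space (fe_order M) (mesh M h) (fespace0 M h);
  stab_gt0 : 0 < stab M;
  nbhd_open : open (nbhd M);
  nbhd_refdom : refdom `<=` nbhd M;
  nbhd_active : forall h, 0 < h <= hmax M -> active_set h `<=` nbhd M;
  extend_bounded : forall s, 0 <= s ->
    bounded_extension refdom (nbhd M) s (extend M s);
  interp_scott_zhang : scott_zhang_type;
  stab_inverse : inverse_inequality
}.

End Method.

(* Main.v *)
Require Import Defs.
From HB Require Import structures.
From mathcomp Require Import all_boot all_order all_algebra all_fingroup.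
From mathcomp Require Import all_classical all_reals all_analysis.
From mathcomp Require Import measurable_realfun ring lra.
Import Order.TTheory GRing.Theory Num.Theory.
Import numFieldNormedType.Exports.
Local Open Scope classical_set_scope.
Local Open Scope ring_scope.

(** Continuity is a Cauchy-Schwarz inequality for each term of the form. The
    matrix [B] has the eigenvalues [gam] and [gam^-1], hence is bounded and
    coercive ([Bmap_bound], [Bmap_coercive]); the boundary terms pair a factor
    [h^(1/2)] with a factor [h^(-1/2)], as in the energy norm; and the
    stabilization form is a nonnegative sum of integrals of products of jumps
    ([s_h_Cauchy_Schwarz]). Finiteness of the energies would need a trace
    theorem; instead, the inequality for integrals is stated in the extended
    reals ([Rintegral_Cauchy_Schwarz]), where it also covers the product of a
    vanishing and an infinite energy. It requires measurable traces. The trace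
    is a pointwise limit of means over balls intersected with the domain, and
    these means are measurable in the centre by Tonelli's theorem
    ([measurable_trace]).

    Coercivity is Nitsche's argument. The consistency terms on the boundary are
    bounded by a small multiple of [h |grad v|^2], which the inverse inequality
    absorbs into the gradient and the stabilization, and a large multiple of
    [h^-1 v^2], which the penalty absorbs for large [beta]. All terms must be
    finite real numbers for this computation. The weak gradient is square
    integrable by definition and the boundary gradient is controlled by the
    inverse inequality. For the boundary values, a finite element function is
    bounded, so its trace is bounded ([trace_bounded]), and the boundary of the
    reference domain has finite length ([length_Fmap_lty]). The latter needs an
    argument at the corner: the power map with exponent [a = gam^-1] multiplies
    the speed of an arc [c] by at most a multiple of [|c|^(a - 1)], which may be
    unbounded, but [|c|] decays at most linearly at the end points of a regular
    arc ([curve_lower_bound]) and [t^(a - 1)] is integrable at [0]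
    ([integral_powR_lty]). *)

Set Implicit Arguments.
Unset Strict Implicit.
Unset Printing Implicit Defensive.

(** * Measurability of limits and of plane sets *)

Section MeasurableTools.
Context {R : realType} {d : measure_display} {T : measurableType d}.
Implicit Types (D : set T) (f g : T -> R).

Lemma measurable_funV D f : measurable_fun D f ->
  measurable_fun D (fun x => (f x)^-1).
Proof.
move=> mf; have mV : measurable_fun setT (@GRing.inv R).
  rewrite (_ : setT = [set 0] `|` ~` [set (0 : R)]); last by rewrite setUv.
  apply/measurable_funU => //; first exact: measurableC.
  split; first exact: measurable_fun_set1.
  apply: open_continuous_measurable_fun.
    by apply: closed_openC; exact: closed_eq.
  move=> x; rewrite inE => /eqP x0; exact: inv_continuous.
exact: measurableT_comp mV mf.
Qed.

Lemma measurable_fun_sqrt D f : measurable_fun D f ->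
  measurable_fun D (fun x => Num.sqrt (f x)).
Proof.
move=> mf; apply: (measurableT_comp (f := @Num.sqrt R)) mf.
by apply: continuous_measurable_fun; exact: sqrt_continuous.
Qed.

(** The set where a sequence of measurable functions converges is measurable,
    because it is the set where the upper and lower limits agree and are
    finite. Outside of it [lim] has the constant default value. *)
Lemma measurable_fun_lim (u : (T -> R)^nat) :
  (forall n, measurable_fun setT (u n)) ->
  measurable_fun setT (fun x => lim (u n x @[n --> \oo])).
Proof.
move=> mu.
pose U n x := (u n x)%:E.
have mU n : measurable_fun setT (U n) by exact/measurable_EFinP.
pose sup x := limn_esup (U ^~ x).
pose inf x := limn_einf (U ^~ x).
have msup : measurable_fun setT sup by exact: measurable_fun_limn_esup.
have minf : measurable_fun setT inf.
  apply: measurableT_comp => //.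
  apply: (measurable_fun_limn_esup (f := fun n x => (- U n x)%E)) => n.
  exact: measurableT_comp.
pose c : set T := (setT `&` [set x | sup x = inf x]) `&`
      (setT `&` [set x | sup x \is a fin_num]).
have mc : measurable c.
  apply: measurableI; first exact: measurable_eqe.
  exact: emeasurable_fin_num.
have cP x : c x <-> cvg (u n x @[n --> \oo]).
  split=> [[[_ /= e] [_ /= fs]]|cu].
    apply/cvg_ex; exists (fine (sup x)).
    suff : U ^~ x @ \oo --> (fine (sup x))%:E by move/fine_cvg.
    rewrite fineK//; apply: (@squeeze_cvge _ _ _ _ (einfs (U ^~ x)) _
      (esups (U ^~ x))).
    - apply: nearW => n; apply/andP; split.
        by apply: ereal_inf_lbound; exists n => /=.
      by apply: ereal_sup_ubound; exists n => /=.
    - rewrite e /inf limn_einf_lim; exact: is_cvg_einfs.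
    - rewrite /sup limn_esup_lim; exact: is_cvg_esups.
  have /cvg_ex[a ua] := cu.
  have Ua : U ^~ x @ \oo --> a%:E by apply: cvg_EFin => //; exact: nearW.
  have [ie se] := cvg_limn_einf_sup Ua.
  by rewrite /c /sup /inf; split; split => //=; rewrite se// ie.
rewrite -(setUv c); apply/measurable_funU => //; first exact: measurableC.
split.
  apply: (@measurable_fun_cvg _ _ _ c u) => [n|x /cP//].
  exact: measurable_funTS.
apply: (eq_measurable_fun (cst point)) => [x|]; last exact: measurable_cst.
by rewrite inE => ncx; rewrite dvgP// => /cP.
Qed.

End MeasurableTools.

Section Plane.
Context {R : realType}.

(** An open set is the union of the countably many squares with rational centre
    and size that it contains. *)
Lemma open_measurable_plane (U : set (R * R)) : open U -> measurable U.
Proof.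
move=> oU.
pose box (q : rat * rat * rat) : set (R * R) :=
  [set x | `|x.1 - ratr q.1.1| < ratr q.2 /\ `|x.2 - ratr q.1.2| < ratr q.2].
have mbox q : measurable (box q).
  rewrite (_ : box q = ball (ratr q.1.1 : R) (ratr q.2) `*`
                       ball (ratr q.1.2 : R) (ratr q.2)); last first.
    by apply/seteqP; split => x /=; rewrite /ball/= !(distrC (ratr _)).
  by apply: measurableX; exact: measurable_ball.
rewrite (_ : U = \bigcup_(q in [set q | box q `<=` U]) box q); last first.
  apply/seteqP; split => [x Ux|x [q /= qU /qU]//].
  have /nbhs_ballP[e /= e0 eU] : nbhs x U by exact: open_nbhs_nbhs.
  have [r /andP[r0 re]] : exists r : rat, 0 < (ratr r : R) < e / 2.
    have [r rI] := rat_in_itvoo (divr_gt0 e0 (ltr0n _ 2)).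
    by exists r; move: rI; rewrite in_itv.
  have near (z : R) : exists s : rat, `|z - ratr s| < ratr r.
    have : z - ratr r < z + ratr r by rewrite ltrD2l gtrN.
    move=> /rat_in_itvoo[s]; rewrite in_itv/= => /andP[s1 s2].
    by exists s; rewrite ltr_distlC; lra.
  have [a xa] := near x.1; have [b xb] := near x.2.
  exists (a, b, r) => // y [/= ya yb]; apply: eU; split; rewrite /ball/=.
    rewrite -(subrKA (ratr a)); apply: le_lt_trans (ler_normD _ _) _.
    by rewrite (distrC _ y.1); lra.
  rewrite -(subrKA (ratr b)); apply: le_lt_trans (ler_normD _ _) _.
  by rewrite (distrC _ y.2); lra.
rewrite bigcup_mkcond; apply: countable_bigcupT_measurable => // q.
by case: ifPn.
Qed.

End Plane.

(** * Lebesgue measure of the plane and measurability of traces *)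

Section LebPlane.
Context {R : realType}.
Implicit Types (D : set (R * R)).

Lemma leb2X (A B : set R) : measurable A -> measurable B ->
  leb2 (A `*` B) = (lebesgue_measure A * lebesgue_measure B)%E.
Proof.
move=> mA mB.
exact: (@product_measure1E _ _ _ _ _ (@lebesgue_measure R) (@lebesgue_measure R)).
Qed.

Lemma leb2_square_lty (r : R) : (leb2 (`[(- r)%R, r] `*` `[(- r)%R, r]) < +oo)%E.
Proof.
rewrite leb2X//= lebesgue_measure_itv/=; case: ifP => _.
  by rewrite -EFinB -EFinM ltry.
by rewrite mule0 ltry.
Qed.

(** The measure axioms are those of the product measure, whose sigma-algebra
    consists of the same sets under another display. *)
Definition plane_leb : set (R * R) -> \bar R := @leb2 R.

Let product_leb :=
  (@lebesgue_measure R \x @lebesgue_measure R)%E : measure _ R.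

Let plane_leb0 : plane_leb set0 = 0%E :> \bar R.
Proof. exact: measure0 product_leb. Qed.

Let plane_leb_ge0 (A : set (R * R)) : (0 <= plane_leb A)%E.
Proof. exact: measure_ge0 product_leb _. Qed.

Let plane_leb_additive : semi_sigma_additive plane_leb.
Proof. exact: (@measure_semi_sigma_additive _ _ _ product_leb). Qed.

HB.instance Definition _ := isMeasure.Build _ (R * R)%type R plane_leb
  plane_leb0 plane_leb_ge0 plane_leb_additive.

Let plane_leb_sigma_finite : sigma_finite setT plane_leb.
Proof.
exists (fun n => `[- n%:R, n%:R] `*` `[- n%:R, n%:R]) => [|n].
  apply/esym/seteqP; split=> // -[a b] _.
  exists (Num.bound (Num.max `|a| `|b|)) => //=.
  have : Num.max `|a| `|b| < (Num.bound (Num.max `|a| `|b|))%:R.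
    by apply: archi_boundP; rewrite le_max normr_ge0.
  by rewrite gt_max => /andP[/ltW ? /ltW ?]; split; rewrite in_itv/= -ler_norml.
by split; [exact: measurableX|exact: leb2_square_lty].
Qed.

HB.instance Definition _ := Measure_isSigmaFinite.Build _ _ _ plane_leb
  plane_leb_sigma_finite.

(** The identity between the two displays is measure preserving. *)
Let ge0_integral_leb2E D (f : R * R -> \bar R) : measurable D ->
  measurable_fun D f -> (forall x, (0 <= f x)%E) ->
  (\int[product_leb]_(x in D) f x = \int[plane_leb]_(x in D) f x)%E.
Proof.
move=> mD mf f0.
pose id12 (x : R * R) : (measurableTypeR R * measurableTypeR R)%type := x.
have mid : measurable_fun setT id12.
  by move=> _ A mA; rewrite setTI.
have := @ge0_integral_pushforward _ _ _ _ R id12 mid plane_leb D f mD mf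
  (fun x _ => f0 x).
by move=> <-.
Qed.

(** Real-valued integrals over the plane are taken in the product of the two
    generated sigma-algebras, extended-valued ones in the sigma-algebra of
    [R * R]; the sets are the same but the structures are not convertible. *)
Lemma Rintegral_leb2E D (f : R * R -> R) : measurable D ->
  measurable_fun D f ->
  \int[@leb2 R]_(x in D) f x = fine (\int[plane_leb]_(x in D) (f x)%:E)%E.
Proof.
move=> mD mf; have mEf : measurable_fun D (EFin \o f) by exact/measurable_EFinP.
rewrite /Rintegral [in LHS]integralE [in RHS]integralE; congr fine.
congr (_ - _)%E; apply: ge0_integral_leb2E => //.
- exact: measurable_funepos.
- exact: measurable_funeneg.
Qed.

End LebPlane.

Section PlaneMeasure.
Context {R : realType}.
Context {d : measure_display} {T : measurableType d}.
Implicit Types (E : set T) (u w : T -> R * R).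

Lemma measurable_fun_fst E u :
  measurable_fun E u -> measurable_fun E (fun t => (u t).1).
Proof. exact: measurableT_comp measurable_fst. Qed.

Lemma measurable_fun_snd E u :
  measurable_fun E u -> measurable_fun E (fun t => (u t).2).
Proof. exact: measurableT_comp measurable_snd. Qed.

Lemma measurable_fun_pair_on E (f g : T -> R) :
  measurable_fun E f -> measurable_fun E g ->
  measurable_fun E (fun t => (f t, g t)).
Proof.
move=> mf mg mE; apply: (eq_measurable_fun (fun t => ((f \_ E) t, (g \_ E) t))) (mE).
  by move=> t tE; rewrite !patchE tE.
apply: measurable_funTS.
by apply: measurable_fun_pair; apply/(measurable_restrictT _ mE).
Qed.

Lemma measurable_dot E u w : measurable_fun E u -> measurable_fun E w ->
  measurable_fun E (fun t => dot (u t) (w t)).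
Proof.
move=> mu mw; apply: measurable_funD; apply: measurable_funM;
  by [exact: measurable_fun_fst|exact: measurable_fun_snd].
Qed.

Lemma measurable_enorm E u :
  measurable_fun E u -> measurable_fun E (fun t => enorm (u t)).
Proof. by move=> mu; apply: measurable_fun_sqrt; exact: measurable_dot. Qed.

Lemma measurable_scale E (s : T -> R) u :
  measurable_fun E s -> measurable_fun E u ->
  measurable_fun E (fun t => scale (s t) (u t)).
Proof.
move=> ms mu.
exact: (measurable_fun_pair_on (measurable_funM ms (measurable_fun_fst mu))
                            (measurable_funM ms (measurable_fun_snd mu))).
Qed.

Lemma measurable_subp E u w : measurable_fun E u -> measurable_fun E w ->
  measurable_fun E (fun t => u t - w t).
Proof.
move=> mu mw; apply: (measurable_fun_pair_on
  (measurable_funB (measurable_fun_fst mu) (measurable_fun_fst mw))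
  (measurable_funB (measurable_fun_snd mu) (measurable_fun_snd mw))).
Qed.

Lemma measurable_Fmap (a : R) E u :
  measurable_fun E u -> measurable_fun E (fun t => Fmap a (u t)).
Proof.
move=> mu; apply: measurable_scale => //; apply: measurable_funM.
  apply: (measurableT_comp (f := fun z : R => z `^ a)).
    exact: measurable_powR.
  exact: measurable_enorm.
by apply: measurable_funV; exact: measurable_enorm.
Qed.

Lemma measurable_Bmap (a : R) E u w :
  measurable_fun E u -> measurable_fun E w ->
  measurable_fun E (fun t => Bmap a (u t) (w t)).
Proof.
move=> mu mw.
have mV := measurable_funV (measurable_enorm mu).
have mc := measurable_funM (measurable_fun_fst mu) mV.
have ms := measurable_funM (measurable_fun_snd mu) mV.
have mw1 := measurable_fun_fst mw; have mw2 := measurable_fun_snd mw.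
have mns := measurableT_comp (@oppr_measurable R setT) ms.
have m1 := measurable_funD (measurable_funM mc mw1) (measurable_funM ms mw2).
have m2 := measurable_funD (measurable_funM mns mw1) (measurable_funM mc mw2).
have ma (c : R) (g : T -> R) :
    measurable_fun E g -> measurable_fun E (fun t => c * g t).
  by move=> mg; apply: measurable_funM => //; exact: measurable_cst.
have n1 := ma a^-1 _ m1; have n2 := ma a _ m2.
apply: (measurable_fun_pair_on
  (measurable_funB (measurable_funM mc n1) (measurable_funM ms n2))
  (measurable_funD (measurable_funM ms n1) (measurable_funM mc n2))).
Qed.

End PlaneMeasure.

Section Trace.
Context {R : realType}.
Implicit Types (D : set (R * R)) (f : R * R -> R) (x y : R * R).

(** The means over [D `&` B(x, r)] are measurable in [x] by Tonelli's theorem,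
    since they are integrals over sections of one measurable set. *)
Lemma measurable_ball_means D f (r : R) : measurable D -> measurable_fun D f ->
  measurable_fun setT (fun x =>
    \int[@leb2 R]_(y in D `&` [set y | enorm (y - x) < r]) f y
    / fine (leb2 (D `&` [set y | enorm (y - x) < r]))).
Proof.
move=> mD mf.
pose B x := D `&` [set y | enorm (y - x) < r].
pose A : set ((R * R) * (R * R)) :=
  (setT `*` D) `&` (setT `&` [set z | enorm (z.2 - z.1) < r]).
have mA : measurable A.
  apply: measurableI; first exact: measurableX.
  have h : measurable_fun setT (fun z : (R * R) * (R * R) => enorm (z.2 - z.1)).
    by apply: measurable_enorm; apply: measurable_subp.
  by apply: measurable_fun_ltr => //; exact: measurable_cst.
have AB x y : A (x, y) <-> B x y.
  by rewrite /A /B /=; tauto.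
have mB x : measurable (B x).
  have := measurable_xsection x mA; rewrite (_ : xsection A x = B x)//.
  by apply/seteqP; split => y /=; rewrite /xsection/= inE => /AB.
have mI (k : R * R -> \bar R) : measurable_fun D k -> (forall y, (0 <= k y)%E) ->
    measurable_fun setT (fun x => (\int[plane_leb]_(y in B x) k y)%E).
  move=> mk k0; pose F := (fun z : (R * R) * (R * R) => k z.2) \_ A.
  have mF : measurable_fun setT F.
    apply/(measurable_restrictT _ mA).
    apply: (measurable_comp (F := D)) => //; last exact: measurable_funTS.
    by move=> _ [z [[_ Dz] _] <-].
  have F0 z : (0 <= F z)%E by rewrite /F patchE; case: ifP.
  have := measurable_fun_fubini_tonelli_F (m2 := plane_leb) F mF F0.
  apply: eq_measurable_fun => x _; rewrite integral_mkcond /fubini_F.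
  apply: eq_integral => y _; rewrite /F !patchE.
  rewrite (_ : ((x, y) \in A) = (y \in B x))//.
  by apply/idP/idP; rewrite !inE => /AB.
apply: measurable_funM.
  apply: (eq_measurable_fun
      (fun x => fine (\int[plane_leb]_(y in B x) (f y)%:E)%E)) => [x _|].
    rewrite Rintegral_leb2E//; first exact: mB.
    by apply: (@measurable_funS _ _ _ _ D) => // y [].
  apply: measurableT_comp.
    exact: fine_measurable.
  rewrite [X in measurable_fun _ X](_ : _ = (fun x =>
      \int[plane_leb]_(y in B x) ((EFin \o f)^\+ y) -
      \int[plane_leb]_(y in B x) ((EFin \o f)^\- y))%E); last first.
    by apply/funext => x; rewrite integralE.
  have mEf : measurable_fun D (EFin \o f) by exact/measurable_EFinP.
  apply: emeasurable_funB; apply: mI => //.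
  - exact: measurable_funepos.
  - exact: measurable_funeneg.
apply: measurable_funV; apply: measurableT_comp; first exact: fine_measurable.
apply: (eq_measurable_fun (fun x => (\int[plane_leb]_(y in B x) cst 1 y)%E)).
  by move=> x _; rewrite integral_cst ?mul1e.
by apply: mI => //; exact: measurable_cst.
Qed.

Lemma measurable_trace D f : measurable D -> measurable_fun D f ->
  measurable_fun setT (trace D f).
Proof.
move=> mD mf; pose r n : R := n.+1%:R^-1.
have := measurable_fun_lim (fun n => measurable_ball_means (r n) mD mf).
move=> h; exact h.
Qed.

End Trace.

(** * The coefficient matrix and the Cauchy-Schwarz inequality for integrals *)

Section Bform.
Context {R : realType}.
Implicit Types (a b x : R * R).

Lemma dot_ge0 a : 0 <= dot a a.
Proof. by rewrite addr_ge0// -expr2 sqr_ge0. Qed.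

Lemma enorm_sqr a : enorm a ^+ 2 = dot a a.
Proof. by rewrite sqr_sqrtr// dot_ge0. Qed.

Lemma enorm_ge0 a : 0 <= enorm a.
Proof. exact: sqrtr_ge0. Qed.

Lemma enorm_eq0 a : enorm a = 0 -> a = 0.
Proof.
move=> /(congr1 (fun z => z ^+ 2)); rewrite enorm_sqr expr0n /= /dot -!expr2.
move=> /eqP; rewrite paddr_eq0 ?sqr_ge0// !sqrf_eq0 => /andP[/eqP a1 /eqP a2].
by case: a a1 a2 => ? ? /= -> ->.
Qed.

Lemma enorm_le_sum (x : R * R) : enorm x <= `|x.1| + `|x.2|.
Proof.
rewrite -[leRHS]ger0_norm ?addr_ge0// -sqrtr_sqr ler_wsqrtr//.
rewrite sqrrD !real_normK ?num_real// /dot !expr2.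
by rewrite -addrA lerD2l lerDr mulrn_wge0// mulr_ge0.
Qed.

Lemma dot_enorm (x y : R * R) : `|dot x y| <= enorm x * enorm y.
Proof.
rewrite -sqrtr_sqr -sqrtrM ?dot_ge0// ler_wsqrtr// -subr_ge0.
have -> : dot x x * dot y y - dot x y ^+ 2 = cross x y ^+ 2.
  by rewrite /dot /cross; ring.
exact: sqr_ge0.
Qed.

Lemma coord_enorm (x : R * R) : `|x.1| <= enorm x /\ `|x.2| <= enorm x.
Proof.
split; rewrite -sqrtr_sqr ler_wsqrtr// /dot !expr2.
  by rewrite lerDl -expr2 sqr_ge0.
by rewrite lerDr -expr2 sqr_ge0.
Qed.

(** In the frame rotated by [Smap x] the form is diagonal. *)
Lemma dot_Bmap (g : R) x a b :
  dot a (Bmap g x b) =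
  g^-1 * (Smap x a).1 * (Smap x b).1 + g * (Smap x a).2 * (Smap x b).2.
Proof. by rewrite /Bmap /dot /=; ring. Qed.

Lemma dot_Smap x a : enorm x != 0 -> dot (Smap x a) (Smap x a) = dot a a.
Proof.
move=> x0; rewrite /dot /Smap /=.
set c := _ / _; set s := _ / _.
have cs : c ^+ 2 + s ^+ 2 = 1.
  have xE : x.1 ^+ 2 + x.2 ^+ 2 = enorm x ^+ 2 by rewrite enorm_sqr /dot !expr2.
  by rewrite !expr_div_n -mulrDl xE divff// expf_neq0.
transitivity ((c ^+ 2 + s ^+ 2) * (a.1 * a.1 + a.2 * a.2)); first by ring.
by rewrite cs mul1r.
Qed.

Lemma Smap0 x a : enorm x = 0 -> Smap x a = 0.
Proof. by move=> x0; rewrite /Smap x0 invr0 !mulr0 oppr0 !mul0r addr0. Qed.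

(** At the origin [Smap] is zero instead of a rotation. *)
Lemma dot_Smap_le x a : dot (Smap x a) (Smap x a) <= dot a a.
Proof.
have [x0|x0] := eqVneq (enorm x) 0; last by rewrite dot_Smap.
by rewrite Smap0// /dot !mulr0 addr0 dot_ge0.
Qed.

Lemma Bmap_bound (g : R) x a b : 0 < g ->
  dot a (Bmap g x b) ^+ 2 <= (g + g^-1) ^+ 2 * (dot a a * dot b b).
Proof.
move=> g0; have gi0 : 0 < g^-1 by rewrite invr_gt0.
rewrite dot_Bmap.
apply: (@le_trans _ _ ((g + g^-1) ^+ 2 *
    (dot (Smap x a) (Smap x a) * dot (Smap x b) (Smap x b)))); last first.
  by rewrite ler_wpM2l ?sqr_ge0// ler_pM ?dot_ge0// dot_Smap_le.
move: (Smap x a) (Smap x b) => [p q] [p' q']; rewrite /dot /=.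
move: (g^-1) gi0 => k k0.
apply: (@le_trans _ _ ((k ^+ 2 * p ^+ 2 + g ^+ 2 * q ^+ 2)
                       * (p' * p' + q' * q'))).
  rewrite -subr_ge0.
  have -> : (k ^+ 2 * p ^+ 2 + g ^+ 2 * q ^+ 2) * (p' * p' + q' * q') -
    (k * p * p' + g * q * q') ^+ 2 = (k * p * q' - g * q * p') ^+ 2 by ring.
  exact: sqr_ge0.
rewrite mulrA ler_wpM2r//; first by rewrite addr_ge0// -expr2 sqr_ge0.
rewrite mulrDr -!expr2 lerD// ler_wpM2r ?sqr_ge0//.
- by rewrite lerXn2r ?nnegrE//; lra.
- by rewrite lerXn2r ?nnegrE//; lra.
Qed.

Lemma Bmap_ge0 (g : R) x a : 0 < g -> 0 <= dot a (Bmap g x a).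
Proof.
move=> g0; rewrite dot_Bmap -!mulrA -!expr2.
by rewrite addr_ge0// mulr_ge0 ?sqr_ge0// ?invr_ge0 ltW.
Qed.

Lemma Bmap_coercive (g : R) x a : 0 < g -> enorm x != 0 ->
  Num.min g g^-1 * dot a a <= dot a (Bmap g x a).
Proof.
move=> g0 x0; rewrite -(dot_Smap _ x0) dot_Bmap -!mulrA -!expr2.
rewrite /dot mulrDr -!expr2; apply: lerD; apply: ler_wpM2r (sqr_ge0 _) _ _ _.
  by rewrite ge_min lexx orbT.
by rewrite ge_min lexx.
Qed.

End Bform.

Section CauchySchwarz.
Context {R : realType} {d : measure_display} {T : measurableType d}.
Variable mu : {measure set T -> \bar R}.
Implicit Types (D : set T) (F G Phi : T -> R).

Lemma Lnorm2_sqrt D F : measurable D -> measurable_fun D F ->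
  (forall x, D x -> 0 <= F x) ->
  ('N[mu]_2%:E [EFin \o (fun x => Num.sqrt ((F \_ D) x))])%E =
  sqrte (\int[mu]_(x in D) (F x)%:E)%E.
Proof.
move=> mD mF F0; rewrite unlock poweR12_sqrt; last first.
  by apply: integral_ge0 => x _; exact: poweR_ge0.
congr sqrte; rewrite [RHS]integral_mkcond; apply: eq_integral => x _.
rewrite /= !patchE; case: ifPn => [/set_mem Dx|_].
  by rewrite ger0_norm ?sqrtr_ge0// powR_mulrn ?sqrtr_ge0// sqr_sqrtr ?F0.
by rewrite sqrtr0 normr0 powR0.
Qed.

(** The bound is an extended real number: with an infinite factor and a vanishing
    one it is [0], and then the integrand vanishes almost everywhere. *)
Lemma Rintegral_Cauchy_Schwarz D Phi F G (K : R) : measurable D -> 0 <= K ->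
  measurable_fun D Phi -> measurable_fun D F -> measurable_fun D G ->
  (forall x, D x -> 0 <= F x) -> (forall x, D x -> 0 <= G x) ->
  (forall x, D x -> Phi x ^+ 2 <= K ^+ 2 * (F x * G x)) ->
  (`|\int[mu]_(x in D) Phi x|%:E <=
   K%:E * (sqrte (\int[mu]_(x in D) (F x)%:E) *
           sqrte (\int[mu]_(x in D) (G x)%:E)))%E.
Proof.
move=> mD K0 mPhi mF mG F0 G0 PhiFG.
pose f x := Num.sqrt ((F \_ D) x); pose g x := Num.sqrt ((G \_ D) x).
have mf : measurable_fun setT f.
  by apply: measurable_fun_sqrt; apply/(measurable_restrictT _ mD).
have mg : measurable_fun setT g.
  by apply: measurable_fun_sqrt; apply/(measurable_restrictT _ mD).
have fg0 x : 0 <= f x * g x by rewrite mulr_ge0 ?sqrtr_ge0.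
have mfg : measurable_fun setT (f \* g) by exact: measurable_funM.
apply: (@le_trans _ _ (`|\int[mu]_(x in D) (Phi x)%:E|)%E).
  by rewrite /Rintegral; case: (\int[mu]_(x in D) _)%E => //=; rewrite normr0 leey.
apply: (@le_trans _ _ (\int[mu]_(x in D) `|(Phi x)%:E|)%E).
  by apply: le_abse_integral => //; exact/measurable_EFinP.
apply: (@le_trans _ _ (\int[mu]_(x in D) (K * (f x * g x))%:E)%E).
  apply: ge0_le_integral => //.
  - by apply: measurableT_comp => //; exact/measurable_EFinP.
  - apply/measurable_EFinP; apply: measurable_funM; first exact: measurable_cst.
    exact: measurable_funTS.
  - move=> x Dx; rewrite lee_fin /f /g !patchE mem_set// -sqrtrM ?F0//.
    rewrite -[leLHS]sqrtr_sqr -[K]ger0_norm// -sqrtr_sqr -sqrtrM ?sqr_ge0//.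
    by rewrite ler_wsqrtr// PhiFG.
rewrite [leLHS](_ : _ = K%:E * \int[mu]_(x in D) (f x * g x)%:E)%E; last first.
  rewrite -ge0_integralZl//; first by apply/measurable_EFinP; exact: measurable_funTS.
  by move=> x _; rewrite lee_fin.
apply: lee_wpmul2l => //.
apply: (@le_trans _ _ ('N[mu]_1[EFin \o (f \* g)%R])%E).
  rewrite Lnorm1; apply: (@le_trans _ _ (\int[mu]_x (f x * g x)%:E)%E).
    apply: ge0_subset_integral => //; first exact/measurable_EFinP.
    by move=> x _; rewrite lee_fin.
  apply: ge0_le_integral => //=.
  - by move=> x _; rewrite lee_fin.
  - exact/measurable_EFinP.
  - by apply/measurable_EFinP; exact: measurableT_comp.
  - by move=> x _; rewrite lee_fin ler_norm.
apply: le_trans.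
  apply: (@hoelder _ _ _ mu f g 2 2) => //.
  by rewrite [RHS](splitr 1) div1r.
by rewrite !Lnorm2_sqrt.
Qed.

End CauchySchwarz.

(** * Finite length of the boundary of the reference domain *)

Section OneDim.
Context {R : realType}.
Implicit Types (a b s t : R) (f g : R -> R).
Notation mu := (@lebesgue_measure R).

Let is_derive_onem t : is_derive t 1 (fun s : R => 1 - s) (-1).
Proof.
apply: (is_derive_eq (is_deriveB (is_derive_cst (1 : R) t 1) (is_derive_id t 1))).
by rewrite sub0r.
Qed.

Let is_derive_two_sided a t : 0 < t -> t < 1 ->
  is_derive t 1 (fun s => s `^ a - (1 - s) `^ a)
    (a * t `^ (a - 1) + a * (1 - t) `^ (a - 1)).
Proof.
move=> t0 t1; have t1' : 0 < 1 - t by rewrite subr_gt0.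
have d2 := @is_derive1_comp _ _ _ t _ _ (is_derive1_powR a t1') (is_derive_onem t).
have d3 := is_deriveB (is_derive1_powR a t0) d2.
by apply: is_derive_eq d3 _; rewrite mulrN1 opprK.
Qed.

(** The weight behaves like a power above [-1] at both end points: its
    antiderivative [G] is bounded on the whole interval, which bounds the
    integrals over the compact intervals [F n] that exhaust it. *)
Lemma integral_powR_lty a : 0 < a ->
  (\int[mu]_(t in `]0%R, 1%R[) (t `^ (a - 1) + (1 - t) `^ (a - 1))%:E < +oo)%E.
Proof.
move=> a0.
pose f t := t `^ (a - 1) + (1 - t) `^ (a - 1).
pose G t := a^-1 * (t `^ a - (1 - t) `^ a).
pose e n : R := n.+3%:R^-1.
have e0 n : 0 < e n by rewrite invr_gt0.
have e12 n : e n < 2^-1 by rewrite ltf_pV2 ?posrE// ltr_nat.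
pose F n : set R := [set` `[e n, 1 - e n]].
have f0 t : 0 <= f t by rewrite addr_ge0 ?powR_ge0.
have dG t : 0 < t -> t < 1 -> is_derive t 1 G (f t).
  move=> t0 t1.
  have d := is_deriveZ a^-1 (is_derive_two_sided a t0 t1).
  apply: is_derive_eq d _; rewrite -mulrDr /GRing.scale /= mulKf ?gt_eqF//.
have cf t : 0 < t -> t < 1 -> {for t, continuous f}.
  move=> t0 t1; apply: differentiable_continuous; apply/derivable1_diffP.
  have t1' : 0 < 1 - t by rewrite subr_gt0.
  apply: derivableD.
    by apply: derivable_powR; rewrite in_itv/= andbT.
  have := @is_derive1_comp _ _ _ t _ _ (is_derive1_powR (a - 1) t1')
    (is_derive_onem t).
  by case.
have G1 t : 0 <= t -> t <= 1 -> `|G t| <= a^-1.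
  move=> t0 t1; rewrite normrM gtr0_norm ?invr_gt0// ler_piMr ?invr_ge0 ?(ltW a0)//.
  have h s : 0 <= s -> s <= 1 -> 0 <= s `^ a <= 1.
    have e1 : (1 : R) `^ a = 1 by rewrite powR1.
    move=> s0 s1; rewrite powR_ge0/= -[leRHS]e1.
    by apply: ge0_ler_powR; rewrite ?nnegrE// ltW.
  have /andP[? ?] := h _ t0 t1.
  have /andP[? ?] : 0 <= (1 - t) `^ a <= 1 by apply: h; lra.
  by rewrite ler_norml; lra.
have intF n : (\int[mu]_(t in F n) (f t)%:E <= (2 * a^-1)%:E)%E.
  have en := e0 n; have e2 := e12 n.
  rewrite (continuous_FTC2 (F := G)).
  - rewrite -EFinB lee_fin.
    apply: le_trans (ler_norm _) _; apply: le_trans (ler_normB _ _) _.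
    by rewrite mulr2n mulrDl mul1r lerD// G1//; lra.
  - by lra.
  - apply: continuous_in_subspaceT => t; rewrite inE/= in_itv/= => /andP[? ?].
    by apply: cf; lra.
  - split.
    + by move=> t; rewrite in_itv/= => /andP[? ?]; have [] := dG t ltac:(lra) ltac:(lra).
    + apply: cvg_at_right_filter; apply: differentiable_continuous.
      by apply/derivable1_diffP; have [] := dG (e n) ltac:(lra) ltac:(lra).
    + apply: cvg_at_left_filter; apply: differentiable_continuous.
      by apply/derivable1_diffP; have [] := dG (1 - e n) ltac:(lra) ltac:(lra).
  - move=> t; rewrite in_itv/= => /andP[? ?].
    by rewrite derive1E; have [_ ->] := dG t ltac:(lra) ltac:(lra).
have mF n : measurable (F n) by exact: measurable_itv.
have bF : \bigcup_n F n = [set` `]0, 1[].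
  apply/seteqP; split => [t [n _]|t].
    rewrite /F /= !in_itv/= => /andP[? ?].
    by move: (e0 n) (e12 n) => ? ?; apply/andP; lra.
  rewrite /= in_itv/= => /andP[t0 t1].
  have [n nt] : exists n, e n < Num.min t (1 - t).
    have m0 : 0 < Num.min t (1 - t) by rewrite lt_min t0 subr_gt0.
    exists (Num.bound (Num.min t (1 - t))^-1).
    rewrite -[ltRHS]invrK ltf_pV2 ?posrE ?invr_gt0//.
    apply: lt_le_trans (archi_boundP _) _; first by rewrite invr_ge0 ltW.
    by rewrite ler_nat; do 3 apply: leqW.
  move: nt; rewrite lt_min => /andP[? ?].
  by exists n => //; rewrite /F /= in_itv/=; apply/andP; lra.
have mf : measurable_fun ([set` `]0, 1[] : set R) f.
  apply: open_continuous_measurable_fun; first exact: interval_open.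
  by move=> t; rewrite inE/= in_itv/= => /andP[? ?]; exact: cf.
have ndF : nondecreasing_seq F.
  move=> m n mn; apply/subsetPset => t; rewrite /F/= !in_itv/= => /andP[? ?].
  have : e n <= e m by rewrite lef_pV2 ?posrE// ler_nat.
  by move=> ?; apply/andP; lra.
rewrite -bF; apply: (@le_lt_trans _ _ (2 * a^-1)%:E); last exact: ltry.
have mfF n : measurable_fun (F n) (EFin \o f).
  apply/measurable_EFinP; apply: measurable_funS mf; first exact: measurable_itv.
  by rewrite -bF; exact: bigcup_sup.
have c := ge0_nondecreasing_set_cvg_integral (mu := mu) ndF mF mfF
  (fun n x _ => f0 x).
by apply: (cvge_to_le c); apply: nearW.
Qed.

End OneDim.

Section EndPoints.
Context {R : realType}.
Implicit Types (a b s t : R) (g : R -> R) (c : R -> R * R).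

(** Where the derivative does not vanish, neither a zero nor a nonzero value
    lets [g] get smaller than a multiple of the distance. *)
Lemma linear_lower_bound g s : derivable g s 1 -> derive1 g s != 0 ->
  exists2 k, 0 < k & \forall t \near s, k * `|t - s| <= `|g t|.
Proof.
move=> dg g'0; have cg : {for s, continuous g}.
  by apply: differentiable_continuous; exact/derivable1_diffP.
have [gs0|gs0] := eqVneq (g s) 0; last first.
  exists (`|g s| / 2); first by rewrite divr_gt0// normr_gt0.
  have n1 : \forall t \near s, `|g s| / 2 < `|g t|.
    have cn : `|g t| @[t --> s] --> `|g s| by apply: cvg_norm; exact: cg.
    apply: (@cvgr_gt _ _ _ _ (fun t => `|g t|) _ cn).
    by rewrite ltr_pdivrMr// ltr_pMr ?normr_gt0// ltr1n.
  have n2 : \forall t \near s, `|t - s| <= 1.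
    have := @nbhsx_ballx R R s 1 ltr01; apply: filterS => t.
    by rewrite /ball /= distrC => /ltW.
  near=> t; apply: (@le_trans _ _ (`|g s| / 2)).
    by rewrite ler_piMr ?divr_ge0//; near: t.
  by rewrite ltW//; near: t.
exists (`|derive1 g s| / 2); first by rewrite divr_gt0// normr_gt0.
have dgs : h^-1 *: (g (h *: 1 + s) - g s) @[h --> (0 : R)^'] --> derive1 g s.
  by rewrite derive1E; exact: dg.
have dgn : `|h^-1 *: (g (h *: 1 + s) - g s)| @[h --> (0 : R)^'] --> `|derive1 g s|.
  exact: cvg_norm dgs.
have /nbhs_ballP[e /= e0 eP] :
    \forall h \near (0 : R)^', `|derive1 g s| / 2 < `|h^-1 *: (g (h *: 1 + s) - g s)|.
  apply: (@cvgr_gt _ _ _ _ (fun h => `|h^-1 *: (g (h *: 1 + s) - g s)|) _ dgn).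
  by rewrite ltr_pdivrMr// ltr_pMr ?normr_gt0// ltr1n.
have := @nbhsx_ballx R R s e e0; apply: filterS => t st.
have [->|ts] := eqVneq t s; first by rewrite subrr normr0 mulr0.
have := eP (t - s); rewrite /ball/= sub0r normrN distrC => /(_ st).
rewrite subr_eq0 => /(_ ts); rewrite gs0 subr0 /GRing.scale/= mulr1 subrK.
rewrite normrM normfV [X in _ < X]mulrC ltr_pdivlMr ?normr_gt0 ?subr_eq0//.
by rewrite distrC => /ltW.
Unshelve. all: by end_near. Qed.

(** Near an end point, [linear_lower_bound] applies to a coordinate with nonzero
    derivative; in between, the distance has a positive minimum. *)
Lemma curve_lower_bound c :
  (forall t, derivable (fun s => (c s).1) t 1) ->
  (forall t, derivable (fun s => (c s).2) t 1) ->
  velocity c 0 != 0 -> velocity c 1 != 0 ->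
  (forall t, 0 < t -> t < 1 -> c t != 0) ->
  exists2 k, 0 < k &
    forall t, 0 < t -> t < 1 -> k * Num.min t (1 - t) <= enorm (c t).
Proof.
move=> d1 d2 v0 v1 c0.
have bnd s : velocity c s != 0 ->
    exists2 k, 0 < k & \forall t \near s, k * `|t - s| <= enorm (c t).
  rewrite /velocity => vs.
  have [e1|e1] := eqVneq (derive1 (fun s => (c s).1) s) 0; last first.
    have [k k0 kP] := linear_lower_bound (d1 s) e1.
    by exists k => //; apply: filterS kP => t h; exact: le_trans h (coord_enorm (c t)).1.
  have [e2|e2] := eqVneq (derive1 (fun s => (c s).2) s) 0.
    by move: vs; rewrite e1 e2 eqxx.
  have [k k0 kP] := linear_lower_bound (d2 s) e2.
  by exists k => //; apply: filterS kP => t h; exact: le_trans h (coord_enorm (c t)).2.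
have [k0 k00 /nbhs_ballP[e0 /= e00 e0P]] := bnd _ v0.
have [k1 k10 /nbhs_ballP[e1 /= e10 e1P]] := bnd _ v1.
pose e := Num.min (Num.min e0 e1) 2^-1 / 2.
have eE : [/\ 0 < e, e < e0, e < e1 & e < 2^-1].
  have m0 : 0 < Num.min (Num.min e0 e1) 2^-1 by rewrite !lt_min e00 e10 /= invr_gt0 ltr0n.
  have : e < Num.min (Num.min e0 e1) 2^-1.
    by rewrite ltr_pdivrMr// ltr_pMr// ltr1n.
  rewrite !lt_min => /andP[/andP[? ?] ?]; split => //.
  by rewrite divr_gt0.
have [e'0 ee0 ee1 e2] := eE.
have cc : {within [set` `[e, 1 - e]], continuous (fun t => enorm (c t))}.
  apply: continuous_in_subspaceT => t _.
  have ct1 : {for t, continuous (fun s => (c s).1)}.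
    by apply: differentiable_continuous; exact/derivable1_diffP.
  have ct2 : {for t, continuous (fun s => (c s).2)}.
    by apply: differentiable_continuous; exact/derivable1_diffP.
  apply: (@continuous_comp _ _ _ (fun t => dot (c t) (c t)) Num.sqrt).
    by apply: cvgD; apply: cvgM.
  exact: sqrt_continuous.
have [z zI zP] := EVT_min (ltac:(lra) : e <= 1 - e) cc.
have z0 : 0 < enorm (c z).
  move: zI; rewrite in_itv/= => /andP[? ?].
  rewrite lt_neqAle enorm_ge0 andbT eq_sym; apply/eqP => /enorm_eq0/eqP.
  by apply/negP; apply: c0; lra.
exists (Num.min (Num.min k0 k1) (enorm (c z))); first by rewrite !lt_min k00 k10.
move=> t t0 t1.
have m0 : 0 <= Num.min t (1 - t) by rewrite le_min; apply/andP; split; lra.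
set k := Num.min _ (enorm _).
have [? ? ?] : [/\ k <= k0, k <= k1 & k <= enorm (c z)].
  by rewrite /k !ge_min !lexx ?orbT.
have [te|te] := ltP t e.
  apply: le_trans (e0P t _); last by rewrite /ball/= sub0r normrN gtr0_norm//; lra.
  by rewrite subr0 gtr0_norm// ler_pM// ?ge_min ?lexx// !le_min !ltW.
have [te'|te'] := ltP (1 - e) t.
  apply: le_trans (e1P t _); last by rewrite /ball/= gtr0_norm//; lra.
  rewrite distrC (@gtr0_norm _ (1 - t)); last by lra.
  by rewrite ler_pM// ?ge_min ?lexx ?orbT// !le_min !ltW.
apply: le_trans (zP t _); last by rewrite in_itv/=; apply/andP.
rewrite -[leRHS]mulr1 ler_pM//; first by rewrite !le_min !ltW.
by rewrite ge_min; apply/orP; left; exact: ltW.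
Qed.

End EndPoints.

Section Speed.
Context {R : realType}.
Variables (a : R) (c : R -> R * R).
Hypothesis a0 : 0 < a.
Hypothesis d1 : forall t : R, derivable (fun s => (c s).1) t 1.
Hypothesis d2 : forall t : R, derivable (fun s => (c s).2) t 1.
Implicit Types t : R.

Let N t := dot (c t) (c t).
Let b := (a - 1) / 2.
Let W t := b * N t `^ (b - 1) * (2 * dot (c t) (velocity c t)).

Let cont1 t : {for t, continuous (fun s => (c s).1)}.
Proof. by apply: differentiable_continuous; exact/derivable1_diffP. Qed.

Let cont2 t : {for t, continuous (fun s => (c s).2)}.
Proof. by apply: differentiable_continuous; exact/derivable1_diffP. Qed.

Let N_gt0 t : c t != 0 -> 0 < N t.
Proof.
move=> c0; rewrite /N lt_neqAle dot_ge0 andbT eq_sym -enorm_sqr sqrf_eq0.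
by apply: contra c0 => /eqP /enorm_eq0 ->.
Qed.

Let Fmap_powR x : x != 0 -> Fmap a x = scale (dot x x `^ b) x.
Proof.
move=> x0; congr scale; rewrite /enorm -powR12_sqrt ?dot_ge0//.
have n0 : dot x x != 0.
  by rewrite -enorm_sqr sqrf_eq0; apply: contra x0 => /eqP /enorm_eq0 ->.
rewrite -powRrM -powRB ?n0 ?implybT//; congr powR.
by rewrite /b; field.
Qed.

Let is_derive_N t : is_derive t 1 N (2 * dot (c t) (velocity c t)).
Proof.
have e1 : is_derive t 1 (fun s => (c s).1) (velocity c t).1.
  by apply: DeriveDef; [exact: d1|rewrite /velocity /= derive1E].
have e2 : is_derive t 1 (fun s => (c s).2) (velocity c t).2.
  by apply: DeriveDef; [exact: d2|rewrite /velocity /= derive1E].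
have := is_deriveD (is_deriveM e1 e1) (is_deriveM e2 e2).
move=> /is_derive_eq; apply; rewrite /dot /GRing.scale /=; ring.
Qed.

(** The chain rule for [|c| ^ (a - 1) c], written with the square of the norm
    to avoid the square root. *)
Lemma velocity_Fmap t : c t != 0 ->
  velocity (fun s => Fmap a (c s)) t =
  (W t * (c t).1 + N t `^ b * (velocity c t).1,
   W t * (c t).2 + N t `^ b * (velocity c t).2).
Proof.
move=> ct0.
have nc0 : \forall s \near t, c s != 0.
  have cN : {for t, continuous N}.
    by apply: cvgD; apply: cvgM; [exact: cont1|exact: cont1|exact: cont2|exact: cont2].
  have Np : \forall s \near t, 0 < N s by exact: @cvgr_gt _ _ _ _ N _ cN 0 (N_gt0 ct0).
  apply: filterS Np => s; apply: contraTneq; rewrite /N => ->.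
  by rewrite /N /dot !mulr0 addr0 ltxx.
have dNb := @is_derive1_comp _ _ _ t _ _ (is_derive1_powR b (N_gt0 ct0)) (is_derive_N t).
have comp (g : R -> R) : derivable g t 1 ->
    is_derive t 1 (fun s => N s `^ b * g s) (W t * g t + N t `^ b * derive1 g t).
  move=> dg.
  have eg : is_derive t 1 g (derive1 g t).
    by apply: DeriveDef; [exact: dg|rewrite derive1E].
  have := is_deriveM dNb eg; move=> /is_derive_eq; apply.
  by rewrite /W /GRing.scale /=; ring.
rewrite [LHS]/velocity; congr pair.
  have [_ e] := comp (fun s => (c s).1) (@d1 t).
  transitivity ('D_1 (fun s => N s `^ b * (c s).1) t); last exact: e.
  rewrite derive1E; apply: near_eq_derive.
  by apply: filterS nc0 => s cs0; rewrite Fmap_powR.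
have [_ e] := comp (fun s => (c s).2) (@d2 t).
transitivity ('D_1 (fun s => N s `^ b * (c s).2) t); last exact: e.
rewrite derive1E; apply: near_eq_derive.
by apply: filterS nc0 => s cs0; rewrite Fmap_powR.
Qed.

Lemma speed_Fmap_bound t : c t != 0 ->
  enorm (velocity (fun s => Fmap a (c s)) t) <=
  2 * (`|a - 1| + 1) * enorm (c t) `^ (a - 1) * enorm (velocity c t).
Proof.
move=> ct0; rewrite velocity_Fmap//; apply: le_trans (enorm_le_sum _) _ => /=.
have Nb : N t `^ b = enorm (c t) `^ (a - 1).
  rewrite /enorm -powR12_sqrt ?dot_ge0// -powRrM; congr powR.
  by rewrite /b mulrC.
set V := enorm (velocity c t); set P := enorm (c t) `^ (a - 1).
have P0 : 0 <= P := powR_ge0 _ _.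
have V0 : 0 <= V := enorm_ge0 _.
have WP : `|W t| * enorm (c t) <= `|a - 1| * P * V.
  rewrite /W 2!normrM [`|2 * _|]normrM (ger0_norm (powR_ge0 _ _)).
  have -> : `|a - 1| * P * V =
      `|b| * N t `^ (b - 1) * (`|2| * (enorm (c t) * V)) * enorm (c t).
    have -> : P = N t `^ (b - 1) * enorm (c t) ^+ 2.
      rewrite enorm_sqr -/(N t); transitivity (N t `^ (b - 1 + 1)).
        by rewrite subrK Nb.
      rewrite powRD; first by rewrite powRr1 ?dot_ge0.
      by apply/implyP => _; rewrite gt_eqF ?N_gt0.
    have -> : `|a - 1| = `|b| * `|2|.
      by rewrite -normrM /b divfK.
    by ring.
  apply: ler_wpM2r (enorm_ge0 _) _ _ _.
  apply: ler_wpM2l; first by rewrite mulr_ge0// powR_ge0.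
  by apply: ler_wpM2l => //; exact: dot_enorm.
have [x1 x2] := coord_enorm (c t); have [y1 y2] := coord_enorm (velocity c t).
have bound (x y : R) : `|x| <= enorm (c t) -> `|y| <= V ->
    `|W t * x + N t `^ b * y| <= (`|a - 1| + 1) * P * V.
  move=> xc yV; apply: le_trans (ler_normD _ _) _.
  rewrite (normrM (W t)) (normrM (N t `^ b)) (ger0_norm (powR_ge0 _ _)) Nb.
  rewrite -/P !mulrDl mul1r lerD//.
    by apply: le_trans WP; rewrite ler_wpM2l.
  by rewrite ler_wpM2l.
have -> : 2 * (`|a - 1| + 1) * P * V =
    (`|a - 1| + 1) * P * V + (`|a - 1| + 1) * P * V by ring.
by rewrite lerD// bound.
Qed.

Hypothesis v1 : continuous (fun t => (velocity c t).1).
Hypothesis v2 : continuous (fun t => (velocity c t).2).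

Let mc : measurable_fun setT c.
Proof.
rewrite (_ : c = fun t => ((c t).1, (c t).2)); last first.
  by apply/funext => t; case: (c t).
apply: measurable_fun_pair_on; apply: continuous_measurable_fun => t.
  exact: cont1.
exact: cont2.
Qed.

Let mv : measurable_fun setT (velocity c).
Proof.
by apply: measurable_fun_pair_on; apply: continuous_measurable_fun => t;
  [exact: v1|exact: v2].
Qed.

Lemma measurable_curve_Fmap : measurable_fun setT (fun t => Fmap a (c t)).
Proof. exact: measurable_Fmap. Qed.

Hypothesis c0 : forall t, 0 < t -> t < 1 -> c t != 0.

Lemma measurable_velocity_Fmap :
  measurable_fun ([set` `]0, 1[] : set R) (velocity (fun s => Fmap a (c s))).
Proof.
have mN : measurable_fun setT N by exact: measurable_dot.
have mP (p : R) : measurable_fun setT (fun t => N t `^ p).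
  by apply: (measurableT_comp (f := fun z : R => z `^ p)) => //; exact: measurable_powR.
have mW : measurable_fun setT W.
  apply: measurable_funM.
    by apply: measurable_funM => //; exact: measurable_cst.
  by apply: measurable_funM; [exact: measurable_cst|exact: measurable_dot].
apply: (eq_measurable_fun (fun t =>
  (W t * (c t).1 + N t `^ b * (velocity c t).1,
   W t * (c t).2 + N t `^ b * (velocity c t).2))).
  move=> t; rewrite inE/= in_itv/= => /andP[t0 t1].
  by rewrite velocity_Fmap ?c0.
apply: measurable_funTS; apply: measurable_fun_pair_on.
  apply: measurable_funD; apply: measurable_funM => //.
    exact: measurable_fun_fst.
  exact: measurable_fun_fst.
apply: measurable_funD; apply: measurable_funM => //.
  exact: measurable_fun_snd.
exact: measurable_fun_snd.
Qed.

Hypothesis v0 : velocity c 0 != 0.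
Hypothesis v1' : velocity c 1 != 0.

(** The image of a regular curve through the power map has finite length, even
    when the curve ends at the origin, where for [a < 1] the speed of the image
    is unbounded. *)
Lemma length_Fmap_lty :
  (\int[@lebesgue_measure R]_(t in `]0%R, 1%R[)
     (enorm (velocity (fun s => Fmap a (c s)) t))%:E < +oo)%E.
Proof.
have bounded (f : R -> R) : continuous f ->
    exists2 B, 0 < B & forall t, 0 < t -> t < 1 -> f t <= B.
  move=> cf; have [z _ zP] := @EVT_max R f 0 1 ler01 (continuous_subspaceT cf).
  exists (`|f z| + 1); first by rewrite ltr_wpDl.
  move=> t t0 t1; apply: (@le_trans _ _ (f z)).
    by apply: zP; rewrite in_itv/= !ltW.
  by apply: le_trans (ler_norm _) _; rewrite lerDl.
have cenorm (f : R -> R * R) : continuous (fun t => (f t).1) ->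
    continuous (fun t => (f t).2) -> continuous (fun t => enorm (f t)).
  move=> f1 f2 t; apply: (@continuous_comp _ _ _ (fun t => dot (f t) (f t)) Num.sqrt).
    by apply: cvgD; apply: cvgM; [exact: f1|exact: f1|exact: f2|exact: f2].
  exact: sqrt_continuous.
have [B B0 BP] := bounded _ (cenorm _ cont1 cont2).
have [V V0 VP] := bounded _ (cenorm _ v1 v2).
have [k k0 kP] := curve_lower_bound d1 d2 v0 v1' c0.
pose w t := t `^ (a - 1) + (1 - t) `^ (a - 1).
have w0 t : 0 <= w t by rewrite addr_ge0 ?powR_ge0.
have mw : measurable_fun setT w.
  apply: measurable_funD; first exact: measurable_powR.
  apply: (measurableT_comp (f := fun z : R => z `^ (a - 1))).
    exact: measurable_powR.
  by apply: measurable_funB.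
(* For [a < 1] the linear lower bound enters, for [1 <= a] the upper bound [B]. *)
have [K K0 KP] : exists2 K, 0 < K & forall t, 0 < t -> t < 1 ->
    enorm (c t) `^ (a - 1) <= K * w t.
  have [a1|a1] := leP 0 (a - 1).
    exists (B `^ (a - 1) / (2^-1 `^ (a - 1))).
      by rewrite divr_gt0// powR_gt0.
    move=> t t0 t1; apply: (@le_trans _ _ (B `^ (a - 1))).
      by apply: ge0_ler_powR; rewrite ?nnegrE ?enorm_ge0 ?(ltW B0)// BP.
    rewrite -mulrA ler_peMr ?powR_ge0// mulrC ler_pdivlMr ?powR_gt0// mul1r.
    have [th|th] := leP 2^-1 t.
      apply: (@le_trans _ _ (t `^ (a - 1))); last by rewrite lerDl powR_ge0.
      by apply: ge0_ler_powR; rewrite ?nnegrE// ltW.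
    apply: (@le_trans _ _ ((1 - t) `^ (a - 1))); last by rewrite lerDr powR_ge0.
    by apply: ge0_ler_powR; rewrite ?nnegrE//; lra.
  exists (k `^ (a - 1)); first by rewrite powR_gt0.
  move=> t t0 t1; pose m := Num.min t (1 - t).
  have m0 : 0 < m by rewrite lt_min t0 subr_gt0.
  apply: (@le_trans _ _ ((k * m) `^ (a - 1))).
    rewrite -[a - 1]opprK !(powRN _ (- (a - 1))) lef_pV2 ?posrE ?powR_gt0//.
    - apply: ge0_ler_powR; rewrite ?nnegrE ?enorm_ge0// ?kP//.
        by rewrite oppr_ge0 ltW.
      by rewrite ltW// mulr_gt0.
    - by rewrite lt_neqAle enorm_ge0 andbT eq_sym; apply: contra (c0 t0 t1) =>
        /eqP /enorm_eq0 ->.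
    - by rewrite mulr_gt0.
  rewrite powRM ?(ltW k0) ?(ltW m0)//; apply: ler_wpM2l; first exact: powR_ge0.
  by rewrite /m /w minEle; case: ifP => _; rewrite (lerDl, lerDr) powR_ge0.
pose C := 2 * (`|a - 1| + 1) * K * V.
have C0 : 0 <= C by rewrite !mulr_ge0// ?addr_ge0// ltW.
apply: (@le_lt_trans _ _ (\int[@lebesgue_measure R]_(t in `]0%R, 1%R[)
   (C%:E * (w t)%:E))%E).
  apply: ge0_le_integral.
  - exact: measurable_itv.
  - by move=> t _; rewrite lee_fin enorm_ge0.
  - by apply/measurable_EFinP; apply: measurable_enorm; exact: measurable_velocity_Fmap.
  - by apply/measurable_EFinP; apply: measurable_funM => //; exact: measurable_funTS.
  - move=> t /=; rewrite in_itv/= => /andP[t0 t1]; rewrite -EFinM lee_fin.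
    apply: le_trans (speed_Fmap_bound (c0 t0 t1)) _.
    have -> : C * w t = 2 * (`|a - 1| + 1) * (K * w t) * V by rewrite /C; ring.
    apply: ler_pM; rewrite ?enorm_ge0 ?VP// ?mulr_ge0 ?addr_ge0 ?powR_ge0//.
    by rewrite ler_wpM2l ?KP// mulr_ge0// addr_ge0.
rewrite ge0_integralZl//.
- rewrite lte_mul_pinfty// ?lee_fin//; exact: integral_powR_lty.
- by apply/measurable_EFinP; exact: measurable_funTS.
- by move=> t _; rewrite lee_fin.
Qed.

End Speed.

(** * Finite element functions and their traces *)

Section PiecewisePolynomials.
Context {R : realType}.
Implicit Types (D : set (R * R)) (q : {poly {poly R}}) (K : seq (R * R)).

Lemma peval_sum q (x : R * R) :
  peval q x = \sum_(i < size q) (q`_i).[x.1] * x.2 ^+ i.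
Proof.
rewrite /peval (horner_coef q) horner_sum; apply: eq_bigr => i _.
by rewrite hornerM -polyC_exp hornerC.
Qed.

Lemma continuous_bigsum I (s : seq I) (F : I -> R -> R) :
  (forall i, continuous (F i)) -> continuous (fun t => \sum_(i <- s) F i t).
Proof.
move=> cF; elim: s => [|i s IH].
  rewrite (_ : (fun _ => _) = cst 0); first exact: cst_continuous.
  by apply/funext => t; rewrite big_nil.
rewrite (_ : (fun _ => _) = fun t => F i t + \sum_(j <- s) F j t); last first.
  by apply/funext => t; rewrite big_cons.
by move=> t; apply: cvgD; [exact: cF|exact: IH].
Qed.

Lemma peval_continuous q (u : R -> R * R) :
  continuous (fun t => (u t).1) -> continuous (fun t => (u t).2) ->
  continuous (fun t => peval q (u t)).
Proof.
move=> u1 u2; rewrite (_ : (fun _ => _) =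
    fun t => \sum_(i < size q) (q`_i).[(u t).1] * (u t).2 ^+ i); last first.
  by apply/funext => t; rewrite peval_sum.
apply: continuous_bigsum => i t; apply: cvgM.
  apply: (@continuous_comp _ _ _ (fun t => (u t).1) (horner q`_i)).
    exact: u1.
  exact: continuous_horner.
apply: (@continuous_comp _ _ _ (fun t => (u t).2) (fun z => z ^+ i)).
  exact: u2.
exact: exprn_continuous.
Qed.

Lemma measurable_peval D q : measurable_fun D (peval q).
Proof.
rewrite (_ : peval q = fun x => \sum_(i < size q) (q`_i).[x.1] * x.2 ^+ i).
  2: by apply/funext => x; rewrite peval_sum.
apply: measurable_sum => i; apply: measurable_funM.
  apply: (measurableT_comp (f := horner q`_i)).
    by apply: continuous_measurable_fun; exact: continuous_horner.
  by apply: measurable_funTS; exact: measurable_fst.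
by apply: measurable_funX; apply: measurable_funTS; exact: measurable_snd.
Qed.

Lemma peval_bounded q :
  exists B, forall x, @square R x -> `|peval q x| <= B.
Proof.
exists (\sum_(i < size q) \sum_(j < size q`_i) `|q`_i`_j|).
move=> x [x1 x2].
have [x1' x2'] : `|x.1| <= 1 /\ `|x.2| <= 1.
  by move: x1 x2; rewrite /= !in_itv/= !ler_norml.
rewrite peval_sum; apply: le_trans (ler_norm_sum _ _ _) _; apply: ler_sum => i _.
rewrite normrM normrX -[leRHS]mulr1.
apply: ler_pM => //; rewrite ?exprn_ge0//.
  rewrite horner_coef; apply: le_trans (ler_norm_sum _ _ _) _.
  apply: ler_sum => j _; rewrite normrM normrX -[leRHS]mulr1.
  by apply: ler_pM; rewrite ?exprn_ge0 ?exprn_ile1.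
exact: exprn_ile1.
Qed.

Lemma measurable_elt K : measurable (elt K).
Proof.
rewrite /elt; elim: (edges K) => [|e s IH].
  rewrite (_ : [set _ | _] = setT)//.
  by apply/seteqP; split => x.
rewrite (_ : [set _ | _] = (setT `&` [set x | 0 <= cross (e.2 - e.1) (x - e.1)])
    `&` [set x | forall e, e \in s -> 0 <= cross (e.2 - e.1) (x - e.1)]).
  apply: measurableI => //.
  have m : measurable_fun setT (fun x : R * R => x - e.1).
    by apply: measurable_subp => //; exact: measurable_cst.
  have mc : measurable_fun setT (fun x : R * R => cross (e.2 - e.1) (x - e.1)).
    apply: measurable_funB; apply: measurable_funM.
    - exact: measurable_cst.
    - exact: measurable_fun_snd.
    - exact: measurable_cst.
    - exact: measurable_fun_fst.
  rewrite (_ : [set x | _] =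
      (fun x : R * R => cross (e.2 - e.1) (x - e.1)) @^-1` [set` `[0, +oo[]); last first.
    by apply/seteqP; split => x /=; rewrite in_itv/= andbT.
  by apply: mc => //; exact: measurable_itv.
apply/seteqP; split => x /=.
  move=> xe; split; first by split => //; apply: xe; rewrite mem_head.
  by move=> e' e's; apply: xe; rewrite inE e's orbT.
by move=> [[_ xe] xs] e'; rewrite inE => /predU1P[->//|]; exact: xs.
Qed.

(** On a finite cover by elements, finitely many polynomials are pasted. *)
Lemma piecewise_polynomial D (T : seq (seq (R * R))) (v : R * R -> R) :
  measurable D -> D `<=` @square R ->
  (forall x, D x -> exists2 K, K \in T & elt K x) ->
  (forall K, K \in T -> exists q, forall x, elt K x -> v x = peval q x) ->
  measurable_fun D v /\ exists B, forall x, D x -> `|v x| <= B.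
Proof.
move=> mD Dsq cover pol.
pose U (T' : seq (seq (R * R))) := D `&` [set x | exists2 K, K \in T' & elt K x].
have DU : D = U T.
  by apply/seteqP; split => [x Dx|x []//]; split => //; exact: cover.
suff : measurable (U T) /\ (measurable_fun (U T) v /\
    exists B, forall x, U T x -> `|v x| <= B) by rewrite -DU => -[].
have : {subset T <= T} by [].
elim: {1 3 4 5}T => [_|K T' IH KT].
  have -> : U [::] = set0 by apply/seteqP; split => x // [_ []].
  by split => //; split; [exact: measurable_fun_set0|exists 0].
have UE : U (K :: T') = (D `&` elt K) `|` U T'.
  apply/seteqP; split => [x [Dx [L]]|x [[Dx Kx]|[Dx [L LT Lx]]]].
  - by rewrite inE => /predU1P[->|? ?]; [left|right; split => //; exists L].
  - by split => //; exists K => //; rewrite mem_head.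
  - by split => //; exists L => //; rewrite inE LT orbT.
have [L LT'|mU [mv [B BP]]] := IH; first by apply: KT; rewrite inE LT' orbT.
have [q qP] := pol K (KT _ (mem_head _ _)).
have [B' B'P] := peval_bounded q.
have mK : measurable (D `&` elt K) by apply: measurableI => //; exact: measurable_elt.
rewrite UE; split; first exact: measurableU.
split.
  apply/measurable_funU => //; split => //.
  apply: (eq_measurable_fun (peval q)); last exact: measurable_peval.
  by move=> x /set_mem[_ Kx]; rewrite qP.
exists (Num.max B' B) => x [[Dx Kx]|Ux]; rewrite le_max.
  by rewrite qP// B'P//; exact: Dsq.
by rewrite BP// orbT.
Qed.

End PiecewisePolynomials.

Section Traces.
Context {R : realType}.
Implicit Types (D : set (R * R)) (v : R * R -> R).

Lemma wder_L2 D i j v : measurable D -> L2_on D (wder D i j v).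
Proof.
move=> mD; rewrite /wder; case: xgetP => [g _ []//|_].
split; first exact: measurable_cst.
have e : (\int[plane_leb]_(x in D) ((0 : R) ^+ 2)%:E = 0)%E.
  by apply: integral0_eq => x _; rewrite expr0n.
suff : (\int[plane_leb]_(x in D) ((0 : R) ^+ 2)%:E < +oo)%E by [].
by rewrite e ltry.
Qed.

Lemma measurable_eball (x : R * R) (r : R) :
  measurable [set y | enorm (y - x) < r].
Proof.
have mn : measurable_fun setT (fun y : R * R => enorm (y - x)).
  by apply: measurable_enorm; apply: measurable_subp => //; exact: measurable_cst.
rewrite -[X in measurable X]setTI (_ : [set y | _] =
    (fun y : R * R => enorm (y - x)) @^-1` [set` `]-oo, r[]); last first.
  by apply/seteqP; split => y /=; rewrite in_itv.
by apply: mn => //; exact: measurable_itv.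
Qed.

(** The trace is an everywhere defined limit of means, with a default value
    where they diverge; a bounded function has a bounded trace. *)
Lemma trace_bounded D v : measurable D -> D `<=` @square R ->
  measurable_fun D v -> (exists B, forall x, D x -> `|v x| <= B) ->
  exists B, forall x, `|trace D v x| <= B.
Proof.
move=> mD Dsq mv [B BP].
pose P := Num.max `|B| `|(point : R)|.
pose u x n := \int[@leb2 R]_(y in D `&` [set y | enorm (y - x) < n.+1%:R^-1]) v y
  / fine (leb2 (D `&` [set y | enorm (y - x) < n.+1%:R^-1])).
exists P => x; rewrite (_ : trace D v x = lim (u x @ \oo))//.
have uP n : `|u x n| <= `|B|.
  rewrite /u; set Bn := D `&` _.
  have mBn : measurable Bn.
    by apply: measurableI => //; exact: measurable_eball.
  have fBn : (plane_leb Bn < +oo)%E.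
    apply: le_lt_trans (leb2_square_lty 1); apply: le_measure; rewrite ?inE//.
      by apply: measurableX; exact: measurable_itv.
    by move=> y [/Dsq].
  have mvB : measurable_fun Bn v.
    by apply: (@measurable_funS _ _ _ _ D) => // y [].
  rewrite (Rintegral_leb2E mBn mvB).
  have le1 : (`|\int[plane_leb]_(y in Bn) (v y)%:E| <= `|B|%:E * plane_leb Bn)%E.
    apply: le_trans (le_abse_integral _ _ _) _ => //; first exact/measurable_EFinP.
    rewrite -integral_cst//; apply: ge0_le_integral => //.
    - by apply/measurable_EFinP; exact: measurableT_comp.
    - by move=> y [Dy _]; rewrite lee_fin; apply: le_trans (BP _ Dy) (ler_norm _).
  have finB : plane_leb Bn \is a fin_num by rewrite ge0_fin_numE.
  move: le1; rewrite -[in X in X -> _](fineK finB) -/(plane_leb Bn).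
  set m := fine (plane_leb Bn); set I := (\int[_]_(y in _) _)%E.
  have m0 : 0 <= m by rewrite fine_ge0.
  rewrite -EFinM => le1.
  have finI : I \is a fin_num.
    by rewrite -abse_fin_num ge0_fin_numE// (le_lt_trans le1)// ltry.
  move: le1; rewrite -(fineK finI) /= lee_fin => le1.
  rewrite normrM normfV (ger0_norm m0).
  have [->|mn0] := eqVneq m 0; first by rewrite invr0 mulr0.
  by rewrite ler_pdivrMr// lt_neqAle eq_sym mn0.
have [cu|ncu] := pselect (cvg (u x @ \oo)).
  rewrite le_max; apply/orP; left.
  rewrite -lim_norm//; apply: limr_le; first exact: is_cvg_norm.
  exact: nearW.
by rewrite dvgP// le_max lexx orbT.
Qed.

End Traces.

(** * The data of the method *)

Section Setting.
Context {R : realType} {M : cutfem R} {omega_c : R}.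
Hypothesis HM : cutfem_setting M omega_c.
Implicit Types (h s : R) (v : R * R -> R) (i : 'I_(narcs M)).
Notation mu := (@lebesgue_measure R).

Lemma measurable_refdom : measurable (refdom M).
Proof.
have [[oO _ _ _] _] := Omega_smooth HM.
rewrite -[X in measurable X]setTI; apply: measurable_Fmap => //.
exact: open_measurable_plane.
Qed.

Let mrefdom := measurable_refdom.

Lemma refdom_in_active h x : 0 < h <= hmax M -> refdom M x ->
  exists2 K, K \in active_mesh M h & elt K x.
Proof.
move=> h0 Dx; have [_ _ cover _] := mesh_is_mesh HM h0.
have : @square R x by exact: refdom_square HM _ Dx.
rewrite -cover => -[K KT Kx]; exists K => //.
rewrite mem_filter KT andbT; apply/asboolP; by exists x.
Qed.

Lemma patch_active h v x : 0 < h <= hmax M -> refdom M x ->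
  (v \_ (active_set M h)) x = v x.
Proof. by move=> h0 Dx; rewrite patchE mem_set//; exact: refdom_in_active. Qed.

(** The reference domain lies in the active mesh, hence functions of the finite
    element space are piecewise polynomial on it. *)
Lemma Vh_measurable_bounded h v : 0 < h <= hmax M -> Vh M h v ->
  measurable_fun (refdom M) v /\
  exists B, forall x, refdom M x -> `|v x| <= B.
Proof.
move=> h0 [w w0 <-]; have [+ _ _] := fespace0_fe HM h0.
move=> /(_ _ w0)[_ wT].
have [||K KT|mw [B BP]] := @piecewise_polynomial R (refdom M) (active_mesh M h) w mrefdom.
- exact: refdom_square HM.
- by move=> x; exact: refdom_in_active.
- move: KT; rewrite mem_filter => /andP[_ /wT[q _ qP]]; by exists q.
split.
  apply: (eq_measurable_fun w) => // x /set_mem Dx.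
  by rewrite patch_active.
by exists B => x Dx; rewrite patch_active// BP.
Qed.

Lemma Hs_plus_Vh_measurable h s v : 0 < h <= hmax M -> 0 <= s ->
  Hs_plus_Vh M h s v -> measurable_fun (refdom M) v.
Proof.
move=> h0 s0 [u [phi [Hu Vphi ->]]].
have [ext _ _] := extend_bounded HM s0.
have [[/(_ 0%N 0%N isT)[g [[mE _] _ _]] _] _] := ext _ Hu.
apply: measurable_funD; last by have [] := Vh_measurable_bounded h0 Vphi.
apply: (eq_measurable_fun (extend M s u)).
  by move=> x /set_mem Dx; rewrite patch_active.
apply: (@measurable_funS _ _ _ _ (nbhd M)) => //.
  exact: open_measurable_plane (nbhd_open HM).
exact: nbhd_refdom HM.
Qed.

Lemma measurable_tr v : measurable_fun (refdom M) v ->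
  measurable_fun setT (trace (refdom M) v).
Proof. exact: measurable_trace. Qed.

Lemma measurable_wgrad v : measurable_fun (refdom M) (wgrad (refdom M) v).
Proof.
apply: measurable_fun_pair_on.
  by have [] := wder_L2 1 0 v mrefdom.
by have [] := wder_L2 0 1 v mrefdom.
Qed.

Lemma measurable_gtrace v : measurable_fun setT (gtrace (refdom M) v).
Proof.
apply: measurable_fun_pair_on; apply: measurable_trace => //.
  by have [] := wder_L2 1 0 v mrefdom.
by have [] := wder_L2 0 1 v mrefdom.
Qed.

Let darc1 i t : derivable (fun s => (Defs.arc i s).1) t 1.
Proof. by have [_ [[/(_ i)[+ _] _ _ _ _] _]] := Omega_smooth HM => /(_ 0%N t). Qed.

Let darc2 i t : derivable (fun s => (Defs.arc i s).2) t 1.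
Proof. by have [_ [[/(_ i)[_ +] _ _ _ _] _]] := Omega_smooth HM => /(_ 0%N t). Qed.

Let varc1 i : continuous (fun t => (velocity (Defs.arc i) t).1).
Proof.
move=> t; apply: differentiable_continuous; apply/derivable1_diffP.
by have [_ [[/(_ i)[+ _] _ _ _ _] _]] := Omega_smooth HM => /(_ 1%N t).
Qed.

Let varc2 i : continuous (fun t => (velocity (Defs.arc i) t).2).
Proof.
move=> t; apply: differentiable_continuous; apply/derivable1_diffP.
by have [_ [[/(_ i)[_ +] _ _ _ _] _]] := Omega_smooth HM => /(_ 1%N t).
Qed.

Let varc_neq0 i t : 0 <= t <= 1 -> velocity (Defs.arc i) t != 0.
Proof. by have [_ [[_ + _ _ _] _]] := Omega_smooth HM; apply. Qed.

(** The origin is an end point of an arc, and arcs only meet at end points. *)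
Let arc_neq0 i t : 0 < t -> t < 1 -> Defs.arc i t != 0.
Proof.
move=> t0 t1; apply/eqP => at0.
have [_ [[_ _ glue meet _] _]] := Omega_smooth HM.
have [w [_ [i0 [c0 _ _]]]] := Omega_corner HM.
have := meet i (next_arc M i0) t 0.
rewrite (ltW t0) t1 lexx ltr01 at0 -glue c0 => /(_ isT isT erefl)[_ te].
by move: t0; rewrite te ltxx.
Qed.

Let gi0 : 0 < (gam M)^-1. Proof. by rewrite invr_gt0; exact: gam_gt0 HM. Qed.

Lemma measurable_refarc i : measurable_fun setT (refarc i).
Proof. exact: (measurable_curve_Fmap (gam M)^-1 (@darc1 i) (@darc2 i)). Qed.

Let mvel i : measurable_fun ([set` `]0, 1[] : set R) (velocity (refarc i)).
Proof.
exact: (measurable_velocity_Fmap (gam M)^-1 (@darc1 i) (@darc2 i) (@varc1 i) (@varc2 i)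
  (@arc_neq0 i)).
Qed.

Let measurable_cc (f : R -> R) : measurable_fun ([set` `]0, 1[] : set R) f ->
  measurable_fun ([set` `[0, 1]] : set R) f.
Proof. exact: measurable_fun_itv_cc. Qed.

Lemma measurable_speed i : measurable_fun ([set` `[0, 1]] : set R) (speed i).
Proof. by apply: measurable_cc; apply: measurable_enorm; exact: mvel. Qed.

Lemma speed_ge0 i t : 0 <= speed i t.
Proof. exact: enorm_ge0. Qed.

Lemma measurable_onormal i :
  measurable_fun ([set` `[0, 1]] : set R) (@onormal _ M i).
Proof.
have m1 := measurable_fun_fst (@mvel i); have m2 := measurable_fun_snd (@mvel i).
have mV := measurable_funV (measurable_enorm (@mvel i)).
have mc (k : R) (f : R -> R) : measurable_fun ([set` `]0, 1[] : set R) f ->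
    measurable_fun ([set` `]0, 1[] : set R) (fun t => k * f t).
  by move=> mf; apply: measurable_funM => //; exact: measurable_cst.
apply: (measurable_fun_pair_on
  (measurable_cc (measurable_funM mV (measurable_funB
    (mc (cos (- (pi / 2))) _ m1) (mc (sin (- (pi / 2))) _ m2))))
  (measurable_cc (measurable_funM mV (measurable_funD
    (mc (sin (- (pi / 2))) _ m1) (mc (cos (- (pi / 2))) _ m2))))).
Qed.

Lemma onormal_le1 i t : dot (onormal i t) (onormal i t) <= 1.
Proof.
rewrite /onormal /speed; move: (velocity _ _) => u.
rewrite /dot /scale /rotate /=.
set c := cos _; set s := sin _.
have cs : c ^+ 2 + s ^+ 2 = 1 by exact: cos2Dsin2.
rewrite [leLHS](_ : _ = (enorm u)^-1 ^+ 2 * ((c ^+ 2 + s ^+ 2) * dot u u)); last first.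
  by rewrite /dot; ring.
rewrite cs mul1r -enorm_sqr -exprMn.
have [->|u0] := eqVneq (enorm u) 0; first by rewrite mulr0 expr0n ler01.
by rewrite mulVf// expr1n.
Qed.

Lemma length_refarc_lty i : (\int[mu]_(t in `[0%R, 1%R]) (speed i t)%:E < +oo)%E.
Proof.
have /measurable_EFinP ms : measurable_fun ([set` `]0, 1[] : set R) (speed i).
  by apply: measurable_enorm; exact: mvel.
rewrite integral_itv_bndoo//.
apply: (length_Fmap_lty gi0 (@darc1 i) (@darc2 i) (@varc1 i) (@varc2 i)
  (@arc_neq0 i)); apply: varc_neq0; rewrite ?lexx ler01//.
Qed.

End Setting.

(** * The stabilization form *)

Section Young.
Context {R : realType}.
Implicit Types (l x y z : R).

(** A Cauchy-Schwarz inequality [x <= sqrt y * sqrt z] in the form of Young's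
    inequalities for all [l]; unlike the former, these are additive. *)
Definition young l x y z := x + x <= l * y + l^-1 * z.

Lemma young0 l : young l 0 0 0.
Proof. by rewrite /young !mulr0. Qed.

Lemma youngD l x y z x' y' z' :
  young l x y z -> young l x' y' z' -> young l (x + x') (y + y') (z + z').
Proof. by rewrite /young => h h'; rewrite !mulrDr; lra. Qed.

Lemma young_scale l k x y z :
  0 <= k -> young l x y z -> young l (k * x) (k * y) (k * z).
Proof.
rewrite /young => k0 h; rewrite -mulrDr !(mulrCA _ k) -mulrDr.
exact: ler_wpM2l.
Qed.

Lemma young_sum (I : Type) (r : seq I) (P : pred I) l (x y z : I -> R) :
  (forall i, P i -> young l (x i) (y i) (z i)) ->
  young l (\sum_(i <- r | P i) x i) (\sum_(i <- r | P i) y i)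
    (\sum_(i <- r | P i) z i).
Proof.
move=> h; elim/big_rec3 : _ => [|i x' y' z' Pi]; first exact: young0.
exact/youngD/h.
Qed.

Lemma young_mul l x y : 0 < l -> young l (x * y) (x * x) (y * y).
Proof.
move=> l0; rewrite /young -subr_ge0.
have -> : l * (x * x) + l^-1 * (y * y) - (x * y + x * y) =
    l^-1 * (l * x - y) ^+ 2 by field; rewrite gt_eqF.
by rewrite mulr_ge0 ?sqr_ge0// invr_ge0 ltW.
Qed.

Lemma young_sqrt x y z : 0 <= y -> 0 <= z ->
  (forall l, 0 < l -> young l x y z) -> x <= Num.sqrt y * Num.sqrt z.
Proof.
move=> y0 z0 h.
have [s st] : exists s, s = Num.sqrt y by exists (Num.sqrt y).
have [t tt] : exists t, t = Num.sqrt z by exists (Num.sqrt z).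
have s0 : 0 <= s by rewrite st sqrtr_ge0.
have t0 : 0 <= t by rewrite tt sqrtr_ge0.
have ys : y = s ^+ 2 by rewrite st sqr_sqrtr.
have zt : z = t ^+ 2 by rewrite tt sqr_sqrtr.
rewrite -st -tt leNgt; apply/negP => stx.
have x0 : 0 < x by apply: le_lt_trans stx; rewrite mulr_ge0.
have [s00|sn0] := eqVneq s 0.
  have l0 : 0 < (z + 1) / x by rewrite divr_gt0// ltr_wpDl.
  have := h _ l0; rewrite /young ys s00 expr0n mulr0 add0r invf_div.
  rewrite mulrAC ler_pdivlMr ?ltr_wpDl//; nra.
have [t00|tn0] := eqVneq t 0.
  have l0 : 0 < x / (y + 1) by rewrite divr_gt0// ltr_wpDl.
  have := h _ l0; rewrite /young zt t00 expr0n mulr0 addr0.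
  rewrite mulrAC ler_pdivlMr ?ltr_wpDl//; nra.
have s0' : 0 < s by rewrite lt_neqAle eq_sym sn0.
have t0' : 0 < t by rewrite lt_neqAle eq_sym tn0.
have := h _ (divr_gt0 t0' s0'); rewrite /young ys zt.
have -> : t / s * s ^+ 2 + (t / s)^-1 * t ^+ 2 = s * t + s * t.
  by field; rewrite sn0 tn0.
by lra.
Qed.

End Young.

Section Stabilization.
Context {R : realType} {M : cutfem R} {omega_c : R}.
Hypothesis HM : cutfem_setting M omega_c.
Implicit Types (h l : R) (v w : R * R -> R).
Notation mu := (@lebesgue_measure R).

Let measurable01 : measurable ([set` `[0 : R, 1]] : set (measurableTypeR R)).
Proof. exact: measurable_itv. Qed.

Let integrable01 (f : R -> R) : continuous f ->
  mu.-integrable [set` `[0, 1]] (EFin \o f).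
Proof.
move=> cf; apply: continuous_compact_integrable; first exact: segment_compact.
exact: continuous_subspaceT.
Qed.

Lemma face_form_ge0 j K L e v : 0 <= face_form M j K L e v v.
Proof.
apply: Rintegral_ge0 => t _; rewrite mulr_ge0 ?enorm_ge0//.
by apply: sumr_ge0 => d _; rewrite -expr2 sqr_ge0.
Qed.

Lemma face_form_young l j K L e v w : 0 < l ->
  young l (face_form M j K L e v w) (face_form M j K L e v v)
    (face_form M j K L e w w).
Proof.
move=> l0.
pose J (d : seq bool) (u : R * R -> R) (x : R * R) :=
  peval (foldr (@pder R) (piece (fe_order M) K u) d) x
  - peval (foldr (@pder R) (piece (fe_order M) L u) d) x.
pose I (u u' : R * R -> R) t := (\sum_(d : j.-tuple bool)
  J d u (segpt e.1 e.2 t) * J d u' (segpt e.1 e.2 t)) * enorm (e.2 - e.1).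
have cs1 : continuous (fun t => (segpt e.1 e.2 t).1).
  by move=> t; apply: cvgD; [exact: cvg_cst|apply: cvgM; [exact: cvg_id|exact: cvg_cst]].
have cs2 : continuous (fun t => (segpt e.1 e.2 t).2).
  by move=> t; apply: cvgD; [exact: cvg_cst|apply: cvgM; [exact: cvg_id|exact: cvg_cst]].
have cJ d u : continuous (fun t => J d u (segpt e.1 e.2 t)).
  by move=> t; apply: cvgB; exact: peval_continuous.
have cI u u' : continuous (I u u').
  move=> t; apply: cvgM; last exact: cvg_cst.
  by apply: continuous_bigsum => d {}t; apply: cvgM; exact: cJ.
have iI u u' := integrable01 (cI u u').
have cZ k u u' : continuous (fun t => k * I u u' t).
  by move=> t; apply: cvgM; [exact: cvg_cst|exact: cI].
change (young l (\int[mu]_(t in `[0, 1]) I v w t)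
  (\int[mu]_(t in `[0, 1]) I v v t) (\int[mu]_(t in `[0, 1]) I w w t)).
rewrite /young.
rewrite -(RintegralD measurable01 (iI v w) (iI v w)).
rewrite -(RintegralZl l measurable01 (iI v v)).
rewrite -(RintegralZl l^-1 measurable01 (iI w w)).
rewrite -(RintegralD measurable01 (integrable01 (cZ _ _ _)) (integrable01 (cZ _ _ _))).
apply: le_Rintegral => //.
- by apply: integrable01 => t; apply: cvgD; exact: cI.
- by apply: integrable01 => t; apply: cvgD; exact: cZ.
move=> t _; suff : young l (I v w t) (I v v t) (I w w t) by [].
rewrite /I ![_ * enorm _]mulrC; apply: young_scale; first exact: enorm_ge0.
by apply: young_sum => d _; exact: young_mul.
Qed.

Lemma s_h_ge0 h v : 0 < h -> 0 <= s_h M h v v.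
Proof.
move=> h0; apply: sumr_ge0 => j _; apply: mulr_ge0.
  by rewrite mulr_ge0 ?exprn_ge0 ?ltW//; exact: stab_gt0 HM.
do 3 (apply: sumr_ge0 => ? _).
exact: face_form_ge0.
Qed.

Lemma s_h_Cauchy_Schwarz h v w : 0 < h ->
  s_h M h v w <= Num.sqrt (s_h M h v v) * Num.sqrt (s_h M h w w).
Proof.
move=> h0; apply: young_sqrt; rewrite ?s_h_ge0// => l l0.
apply: young_sum => j _; apply: young_scale.
  by rewrite mulr_ge0 ?exprn_ge0 ?ltW//; exact: stab_gt0 HM.
do 3 (apply: young_sum => ? _).
exact: face_form_young.
Qed.

End Stabilization.

(** * Continuity and coercivity *)

Section Estimates.
Context {R : realType} {M : cutfem R} {omega_c : R}.
Hypothesis HM : cutfem_setting M omega_c.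
Implicit Types (h beta : R) (v w : R * R -> R) (i : 'I_(narcs M)).
Notation mu := (@lebesgue_measure R).
Notation D := (refdom M).
Notation B := (Bmap (gam M)).

Let mD : measurable D := measurable_refdom HM.
Let m01 : measurable ([set` `[0 : R, 1]] : set (measurableTypeR R)).
Proof. exact: measurable_itv. Qed.
Let g0 : 0 < gam M := gam_gt0 HM.
(** An upper bound of both eigenvalues of [B]. *)
Let K : R := gam M + (gam M)^-1.
Let K0 : 0 < K. Proof. by rewrite addr_gt0 ?invr_gt0. Qed.

Let tr_arc v i (t : measurableTypeR R) : R := trace D v (refarc i t).
Let grad_arc v i (t : measurableTypeR R) : R * R := gtrace D v (refarc i t).
Let flux v i (t : measurableTypeR R) : R :=
  dot (onormal i t) (B (refarc i t) (grad_arc v i t)).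
Let tr_density v i (t : measurableTypeR R) : R := tr_arc v i t ^+ 2 * speed i t.
Let grad_density v i (t : measurableTypeR R) : R :=
  dot (grad_arc v i t) (grad_arc v i t) * speed i t.
Let vol_term v w := \int[@leb2 R]_(x in D) dot (wgrad D v x) (B x (wgrad D w x)).
Let flux_term v w i := \int[mu]_(t in `[0, 1]) (flux v i t * tr_arc w i t * speed i t).
Let penalty_term beta h v w i := \int[mu]_(t in `[0, 1])
  (tr_arc v i t * (beta * h^-1 * tr_arc w i t - flux w i t) * speed i t).

Let A_hE beta h v w : A_h M beta h v w =
  vol_term v w - \sum_i flux_term v w i + \sum_i penalty_term beta h v w i
  + s_h M h (interp M h v) (interp M h w).
Proof. by []. Qed.

Notation I01 := ([set` `[0 : R, 1]] : set (measurableTypeR R)).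

Let mtr v i : measurable_fun D v -> measurable_fun I01 (tr_arc v i).
Proof.
move=> mv; have m := measurable_tr HM mv; have c := measurable_refarc HM i.
exact: measurable_funTS (measurableT_comp m c).
Qed.

Let mgt v i : measurable_fun I01 (grad_arc v i).
Proof.
have m := measurable_gtrace HM v; have c := measurable_refarc HM i.
exact: measurable_funTS (measurableT_comp m c).
Qed.

Let msp i : measurable_fun I01 (speed i).
Proof. exact: measurable_speed HM i. Qed.

Let mflux v i : measurable_fun I01 (flux v i).
Proof.
apply: measurable_dot; first exact: measurable_onormal HM i.
apply: measurable_Bmap; last exact: mgt.
exact: measurable_funTS (measurable_refarc HM i).
Qed.

Let mtr2 v i : measurable_fun D v -> measurable_fun I01 (tr_density v i).
Proof.
move=> mv; apply: measurable_funM; last exact: msp.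
by apply: measurable_funX; exact: mtr.
Qed.

Let mgt2 v i : measurable_fun I01 (grad_density v i).
Proof. by apply: measurable_funM; [apply: measurable_dot; exact: mgt|exact: msp]. Qed.

Let tr_density_ge0 v i t : 0 <= tr_density v i t.
Proof. by rewrite mulr_ge0 ?sqr_ge0 ?speed_ge0. Qed.

Let grad_density_ge0 v i t : 0 <= grad_density v i t.
Proof. by rewrite mulr_ge0 ?dot_ge0 ?speed_ge0. Qed.

Let flux_bound v i t : flux v i t ^+ 2 <= K ^+ 2 * dot (grad_arc v i t) (grad_arc v i t).
Proof.
apply: le_trans (Bmap_bound _ _ _ g0) _; apply: ler_wpM2l; first exact: sqr_ge0.
by rewrite ler_piMl ?dot_ge0// onormal_le1.
Qed.

Let itr2 v i : \bar R := (\int[mu]_(t in `[0%R, 1%R]) (tr_density v i t)%:E)%E.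
Let igt2 v i : \bar R := (\int[mu]_(t in `[0%R, 1%R]) (grad_density v i t)%:E)%E.

Let itr2_ge0 v i : (0 <= itr2 v i)%E.
Proof. by apply: integral_ge0 => t _; rewrite lee_fin. Qed.

Let igt2_ge0 v i : (0 <= igt2 v i)%E.
Proof. by apply: integral_ge0 => t _; rewrite lee_fin. Qed.

Let grad_ge0 v : (0 <= grad_norm2 M v)%E.
Proof.
rewrite -[grad_norm2 M v]/(\int[plane_leb]_(x in D)
  (dot (wgrad D v x) (wgrad D v x))%:E)%E.
by apply: integral_ge0 => x _; rewrite lee_fin dot_ge0.
Qed.

Let energy2E h v : energy2 M h v =
  (grad_norm2 M v + h%:E * (\sum_i igt2 v i) + (h^-1)%:E * (\sum_i itr2 v i)
   + (s_h M h (interp M h v) (interp M h v))%:E)%E.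
Proof. by []. Qed.

Let scaled_sum_ge0 (F : 'I_(narcs M) -> \bar R) (k : R) :
  0 < k -> (forall j, (0 <= F j)%E) -> (0 <= k%:E * \sum_j F j)%E.
Proof. by move=> k0 F0; rewrite mule_ge0 ?lee_fin ?(ltW k0)// sume_ge0. Qed.

Let scaled_le_sum (F : 'I_(narcs M) -> \bar R) (k : R) i :
  0 < k -> (forall j, (0 <= F j)%E) -> (k%:E * F i <= k%:E * \sum_j F j)%E.
Proof.
move=> k0 F0; apply: lee_wpmul2l; first by rewrite lee_fin ltW.
by rewrite (bigD1 i)//= leeDl// sume_ge0.
Qed.

Let sh_ge0 h v : 0 < h -> (0 <= (s_h M h v v)%:E)%E.
Proof. by move=> h0; rewrite lee_fin; apply: s_h_ge0 HM _ _ _. Qed.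

Let le_sum4 (a b c d : \bar R) :
  (0 <= a)%E -> (0 <= b)%E -> (0 <= c)%E -> (0 <= d)%E ->
  [/\ (a <= a + b + c + d)%E, (c + b <= a + b + c + d)%E & (d <= a + b + c + d)%E].
Proof.
move=> a0 b0 c0 d0; split.
- by rewrite -!addeA leeDl// !adde_ge0.
- by rewrite -(addeA a) (addeC b) addeAC leeDr// adde_ge0.
- by rewrite leeDr// !adde_ge0.
Qed.

Let energy2_terms h v : 0 < h ->
  [/\ (grad_norm2 M v <= energy2 M h v)%E,
      ((h^-1)%:E * (\sum_i itr2 v i) + h%:E * (\sum_i igt2 v i)
        <= energy2 M h v)%E
    & ((s_h M h (interp M h v) (interp M h v))%:E <= energy2 M h v)%E].
Proof.
by move=> h0; rewrite energy2E; apply: le_sum4;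
  rewrite ?grad_ge0 ?sh_ge0//; apply: scaled_sum_ge0; rewrite ?invr_gt0.
Qed.

Let arc_le_energy2 h v i : 0 < h ->
  ((h^-1)%:E * itr2 v i + h%:E * igt2 v i <= energy2 M h v)%E.
Proof.
move=> h0; have [_ + _] := energy2_terms v h0; apply: le_trans.
by apply: leeD; apply: scaled_le_sum; rewrite ?invr_gt0.
Qed.

Let energy2_ge0 h v : 0 < h -> (0 <= energy2 M h v)%E.
Proof.
by move=> h0; have [+ _ _] := energy2_terms v h0; apply: le_trans.
Qed.

Let sqrte_le (a b : \bar R) : (0 <= b)%E -> (a <= b)%E -> (sqrte a <= sqrte b)%E.
Proof. by move=> b0 ab; rewrite lee_sqrt. Qed.

Let vol_term_bound h v w : 0 < h ->
  (`|vol_term v w|%:E <= K%:E * (energy M h v * energy M h w))%E.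
Proof.
move=> h0.
have mw (u : R * R -> R) := measurable_wgrad HM u.
have mPhi : measurable_fun D (fun x => dot (wgrad D v x) (B x (wgrad D w x))).
  apply: measurable_dot => //; apply: measurable_Bmap => //.
rewrite /vol_term (Rintegral_leb2E mD mPhi).
have := @Rintegral_Cauchy_Schwarz R _ _ plane_leb D _
  (fun x => dot (wgrad D v x) (wgrad D v x))
  (fun x => dot (wgrad D w x) (wgrad D w x)) K mD (ltW K0) mPhi.
move=> /(_ (measurable_dot (mw v) (mw v)) (measurable_dot (mw w) (mw w))).
move=> /(_ (fun x _ => dot_ge0 _) (fun x _ => dot_ge0 _)).
move=> /(_ (fun x _ => Bmap_bound _ _ _ g0)) /le_trans; apply.
apply: lee_wpmul2l; first by rewrite lee_fin ltW.
have le u : (sqrte (\int[plane_leb]_(x in D) (dot (wgrad D u x) (wgrad D u x))%:E)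
    <= energy M h u)%E.
  apply: sqrte_le; first exact: energy2_ge0.
  by have [le _ _] := energy2_terms u h0; exact: le.
apply: lee_pmul; [exact: sqrte_ge0|exact: sqrte_ge0|exact: le|exact: le].
Qed.

(** [F] and [G] are meant to carry opposite powers of [h], which leaves a
    constant [k] independent of [h]. *)
Let arc_bound (k : R) (Phi F G : measurableTypeR R -> R) h v w i : 0 < h -> 0 <= k ->
  measurable_fun I01 Phi -> measurable_fun I01 F -> measurable_fun I01 G ->
  (forall t, 0 <= F t) -> (forall t, 0 <= G t) ->
  (forall t, Phi t ^+ 2 <= k ^+ 2 * (F t * G t)) ->
  (forall t, F t <= h^-1 * tr_density v i t + h * grad_density v i t) ->
  (forall t, G t <= h^-1 * tr_density w i t + h * grad_density w i t) ->
  measurable_fun D v -> measurable_fun D w ->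
  (`|\int[mu]_(t in `[0, 1]) Phi t|%:E <= k%:E * (energy M h v * energy M h w))%E.
Proof.
move=> h0 k0 mPhi mF mG F0 G0 PhiFG Fv Gw mv mw.
have := @Rintegral_Cauchy_Schwarz R _ _ mu _ Phi F G k m01 k0 mPhi mF mG.
move=> /(_ (fun t _ => F0 t) (fun t _ => G0 t) (fun t _ => PhiFG t)).
move=> /le_trans; apply; apply: lee_wpmul2l; first by rewrite lee_fin.
have bnd (u : R * R -> R) (H : measurableTypeR R -> R) : measurable_fun D u ->
    measurable_fun I01 H -> (forall t, 0 <= H t) ->
    (forall t, H t <= h^-1 * tr_density u i t + h * grad_density u i t) ->
    (sqrte (\int[mu]_(t in `[0%R, 1%R]) (H t)%:E) <= energy M h u)%E.
  move=> mu' mH H0 Hu; apply: sqrte_le; first exact: energy2_ge0.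
  apply: le_trans (arc_le_energy2 u i h0).
  have hi0 : 0 <= h^-1 by rewrite invr_ge0 ltW.
  have mt := @mtr2 u i mu'; have mg := @mgt2 u i.
  rewrite /itr2 /igt2 -ge0_integralZl//; last 2 first.
  - exact/measurable_EFinP.
  - by move=> t _; rewrite lee_fin.
  rewrite -ge0_integralZl//; last 3 first.
  - exact/measurable_EFinP.
  - by move=> t _; rewrite lee_fin.
  - by rewrite lee_fin ltW.
  rewrite -ge0_integralD//; last 4 first.
  - by move=> t _; rewrite -EFinM lee_fin mulr_ge0.
  - by apply/measurable_EFinP; apply: measurable_funM => //; exact: measurable_cst.
  - by move=> t _; rewrite -EFinM lee_fin mulr_ge0// ltW.
  - by apply/measurable_EFinP; apply: measurable_funM => //; exact: measurable_cst.
  apply: ge0_le_integral => //.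
  - by move=> t _; rewrite lee_fin.
  - exact/measurable_EFinP.
  - by apply: emeasurable_funD; apply/measurable_EFinP; apply: measurable_funM => //;
      exact: measurable_cst.
  - by move=> t _; rewrite -!EFinM -EFinD lee_fin.
apply: lee_pmul; [exact: sqrte_ge0|exact: sqrte_ge0|exact: bnd|exact: bnd].
Qed.

Let mscale (k : R) (f : measurableTypeR R -> R) : measurable_fun I01 f ->
  measurable_fun I01 (fun t => k * f t).
Proof. by move=> mf; apply: measurable_funM => //; exact: measurable_cst. Qed.

Let flux_term_measurable v w i : measurable_fun D w ->
  measurable_fun I01 (fun t => flux v i t * tr_arc w i t * speed i t).
Proof.
move=> mw; apply: measurable_funM; last exact: msp.
by apply: measurable_funM; [exact: mflux|exact: mtr].
Qed.

Let flux_term_sqr v w i t : (flux v i t * tr_arc w i t * speed i t) ^+ 2 <=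
  K ^+ 2 * (grad_density v i t * tr_density w i t).
Proof.
rewrite /grad_density /tr_density; have := flux_bound v i t.
have -> : (flux v i t * tr_arc w i t * speed i t) ^+ 2 =
  flux v i t ^+ 2 * (tr_arc w i t ^+ 2 * speed i t ^+ 2) by ring.
have -> : K ^+ 2 * (dot (grad_arc v i t) (grad_arc v i t) * speed i t *
    (tr_arc w i t ^+ 2 * speed i t)) =
  K ^+ 2 * dot (grad_arc v i t) (grad_arc v i t) * (tr_arc w i t ^+ 2 * speed i t ^+ 2) by ring.
by apply: ler_wpM2r; rewrite mulr_ge0 ?sqr_ge0.
Qed.

Let flux_term_bound h v w i : 0 < h -> measurable_fun D v -> measurable_fun D w ->
  (`|flux_term v w i|%:E <= K%:E * (energy M h v * energy M h w))%E.
Proof.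
move=> h0 mv mw; have hi0 : 0 <= h^-1 by rewrite invr_ge0 ltW.
have g20 := grad_density_ge0; have t20 := tr_density_ge0.
apply: (@arc_bound K _ (fun t => h * grad_density v i t) (fun t => h^-1 * tr_density w i t)
  h v w i h0 (ltW K0) (@flux_term_measurable v w i mw)) => //.
- exact: mscale.
- by apply: mscale; exact: mtr2.
- by move=> t; rewrite mulr_ge0// ltW.
- by move=> t; rewrite mulr_ge0.
- move=> t; have -> : h * grad_density v i t * (h^-1 * tr_density w i t) = grad_density v i t * tr_density w i t.
    by field; rewrite gt_eqF.
  exact: flux_term_sqr.
- by move=> t; rewrite lerDr mulr_ge0.
- by move=> t; rewrite lerDl mulr_ge0// ltW.
Qed.

Let penalty_term_measurable beta h v w i : measurable_fun D v -> measurable_fun D w ->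
  measurable_fun I01 (fun t =>
    tr_arc v i t * (beta * h^-1 * tr_arc w i t - flux w i t) * speed i t).
Proof.
move=> mv mw; apply: measurable_funM; last exact: msp.
apply: measurable_funM; first exact: mtr.
apply: measurable_funB; last exact: mflux.
by apply: mscale; exact: mtr.
Qed.

Let sqr_le_sum (a b : R) : 0 <= a -> 0 <= b ->
  2 * a ^+ 2 <= (2 * (a + b)) ^+ 2.
Proof. by move=> a0 b0; have := mulr_ge0 a0 b0; nra. Qed.

Let penalty_term_bound beta h v w i : 0 < beta -> 0 < h ->
  measurable_fun D v -> measurable_fun D w ->
  (`|penalty_term beta h v w i|%:E <= (2 * (beta + K))%:E * (energy M h v * energy M h w))%E.
Proof.
move=> b0 h0 mv mw; have hi0 : 0 <= h^-1 by rewrite invr_ge0 ltW.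
have k0 : 0 <= 2 * (beta + K) by rewrite mulr_ge0// addr_ge0 ?ltW.
apply: (@arc_bound _ _ (fun t => h^-1 * tr_density v i t)
  (fun t => h^-1 * tr_density w i t + h * grad_density w i t)
  h v w i h0 k0 (@penalty_term_measurable beta h v w i mv mw)) => //.
- by apply: mscale; exact: mtr2.
- by apply: measurable_funD; apply: mscale; [exact: mtr2|exact: mgt2].
- by move=> t; rewrite mulr_ge0.
- by move=> t; rewrite addr_ge0// mulr_ge0// ltW.
- move=> t; rewrite /tr_density /grad_density; have := flux_bound w i t.
  have := dot_ge0 (grad_arc w i t); have := sqr_ge0 (tr_arc w i t).
  set f := flux w i t; set g := dot _ _; set a := tr_arc v i t; set b := tr_arc w i t.
  set s := speed i t => bb0 gg0 fg.
  have -> : (a * (beta * h^-1 * b - f) * s) ^+ 2 =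
    h^-1 * (a ^+ 2 * s ^+ 2) * (h * (beta * h^-1 * b - f) ^+ 2).
    by field; rewrite gt_eqF.
  have -> : (2 * (beta + K)) ^+ 2 * (h^-1 * (a ^+ 2 * s) *
      (h^-1 * (b ^+ 2 * s) + h * (g * s))) =
    h^-1 * (a ^+ 2 * s ^+ 2) * ((2 * (beta + K)) ^+ 2 * (h^-1 * b ^+ 2 + h * g)).
    by ring.
  apply: ler_wpM2l.
    by apply: mulr_ge0 => //; apply: mulr_ge0; exact: sqr_ge0.
  apply: (@le_trans _ _ (2 * beta ^+ 2 * (h^-1 * b ^+ 2) + h * (2 * f ^+ 2))).
    rewrite -subr_ge0.
    have -> : 2 * beta ^+ 2 * (h^-1 * b ^+ 2) + h * (2 * f ^+ 2)
      - h * (beta * h^-1 * b - f) ^+ 2 = h * (beta * h^-1 * b + f) ^+ 2.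
      by field; rewrite gt_eqF.
    by rewrite mulr_ge0 ?sqr_ge0// ltW.
  have P0 : 0 <= h^-1 * b ^+ 2 by rewrite mulr_ge0.
  have Q0 : 0 <= h * g by apply: mulr_ge0; [exact: ltW|exact: gg0].
  apply: (@le_trans _ _ (2 * beta ^+ 2 * (h^-1 * b ^+ 2) + 2 * K ^+ 2 * (h * g))).
    rewrite lerD2l [leRHS](_ : _ = h * (2 * (K ^+ 2 * g))); last by ring.
    by apply: ler_wpM2l; rewrite ?(ltW h0)//; apply: ler_wpM2l.
  have bK := sqr_le_sum (ltW b0) (ltW K0).
  have Kb : 2 * K ^+ 2 <= (2 * (beta + K)) ^+ 2.
    by rewrite (addrC beta); apply: sqr_le_sum; exact: ltW.
  rewrite [leRHS]mulrDr.
  by apply: lerD; [exact: (ler_wpM2r P0)|exact: (ler_wpM2r Q0)].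
- by move=> t; rewrite lerDl mulr_ge0// ltW.
Qed.

Theorem form_continuous beta : 0 < beta -> exists2 C : R, 0 < C &
  forall h v w, 0 < h -> measurable_fun D v -> measurable_fun D w ->
    ((A_h M beta h v w)%:E <= C%:E * energy M h v * energy M h w)%E.
Proof.
move=> b0; pose m : R := (narcs M)%:R.
have m0 : 0 <= m by rewrite ler0n.
have C0 : 0 < K + m * K + m * (2 * (beta + K)) + 1.
  have b1 := ltW b0; have k1 := ltW K0.
  have p1 : 0 <= m * K by rewrite mulr_ge0.
  have p2 : 0 <= m * (2 * (beta + K)) by rewrite !mulr_ge0// addr_ge0.
  by lra.
exists (K + m * K + m * (2 * (beta + K)) + 1) => //.
move=> h v w h0 mv mw; rewrite A_hE -muleA.
have := vol_term_bound v w h0; have := fun i => flux_term_bound i h0 mv mw.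
have := fun i => penalty_term_bound i b0 h0 mv mw.
have : ((s_h M h (interp M h v) (interp M h w))%:E <=
    energy M h v * energy M h w)%E.
  apply: (@le_trans _ _ (sqrte (s_h M h (interp M h v) (interp M h v))%:E *
                         sqrte (s_h M h (interp M h w) (interp M h w))%:E)%E).
    by rewrite -EFinM lee_fin; exact: s_h_Cauchy_Schwarz HM _ _ _ h0.
  have le u : (sqrte (s_h M h (interp M h u) (interp M h u))%:E <= energy M h u)%E.
    apply: sqrte_le; first exact: energy2_ge0.
    by have [_ _ le] := energy2_terms u h0; exact: le.
  apply: lee_pmul; [exact: sqrte_ge0|exact: sqrte_ge0|exact: le|exact: le].
have : (0 <= energy M h v * energy M h w)%E by rewrite mule_ge0 ?sqrte_ge0.
case: (energy M h v * energy M h w)%E => [x| |//].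
  rewrite !lee_fin => x0 sx penalty_x flux_x vol_x.
  have sumx (F : 'I_(narcs M) -> R) (k : R) : (forall i, `|F i| <= k * x) ->
      `|\sum_i F i| <= m * (k * x).
    move=> Fx; apply: le_trans (ler_norm_sum _ _ _) _.
    apply: le_trans (ler_sum _ (fun i _ => Fx i)) _.
    by rewrite sumr_const card_ord mulr_natl.
  have t1 : `|\sum_i flux_term v w i| <= m * (K * x) by apply: sumx => i; exact: flux_x.
  have t2 : `|\sum_i penalty_term beta h v w i| <= m * (2 * (beta + K) * x).
    by apply: sumx => i; exact: penalty_x.
  rewrite (_ : _ * x = K * x + m * (K * x) + m * (2 * (beta + K) * x) + x).
    2: by ring.
  apply: lerD => //; apply: lerD; last exact: le_trans (ler_norm _) t2.
  apply: lerD; first exact: le_trans (ler_norm _) vol_x.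
  by apply: le_trans (ler_norm _) _; rewrite normrN.
(* The product of the energies is infinite. A vanishing energy times an infinite
   one is [0] and belongs to the case above. *)
move=> _ _ _ _ _; rewrite gt0_muley ?leey// lte_fin.
Qed.

Let grad_fin v : grad_norm2 M v \is a fin_num.
Proof.
rewrite ge0_fin_numE ?grad_ge0//.
have [m1 F1] := wder_L2 1 0 v mD; have [m2 F2] := wder_L2 0 1 v mD.
have f1 : (\int[plane_leb]_(x in D) (wder D 1 0 v x ^+ 2)%:E < +oo)%E := F1.
have f2 : (\int[plane_leb]_(x in D) (wder D 0 1 v x ^+ 2)%:E < +oo)%E := F2.
clear F1 F2; change (\int[plane_leb]_(x in D)
  (dot (wgrad D v x) (wgrad D v x))%:E < +oo)%E.
rewrite (_ : (\int[plane_leb]_(x in D) _)%E =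
  (\int[plane_leb]_(x in D) (wder D 1 0 v x ^+ 2)%:E +
   \int[plane_leb]_(x in D) (wder D 0 1 v x ^+ 2)%:E)%E).
  exact: lte_add_pinfty f1 f2.
rewrite -ge0_integralD//.
- by move=> x _; rewrite lee_fin sqr_ge0.
- by apply/measurable_EFinP; exact: (measurable_funX 2 m1).
- by move=> x _; rewrite lee_fin sqr_ge0.
- by apply/measurable_EFinP; exact: (measurable_funX 2 m2).
Qed.

Let leb0 : plane_leb [set (0 : R * R)] = 0%E.
Proof.
rewrite (_ : [set 0] = [set 0] `*` [set 0]); last first.
  by apply/seteqP; split => [x ->|[x y] /= [-> ->]].
rewrite [LHS]leb2X; [|exact: measurable_set1|exact: measurable_set1].
by rewrite lebesgue_measure_set1 mul0e.
Qed.

Let mlow : R := Num.min (gam M) (gam M)^-1.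

(** The form is only coercive away from the origin, a null set. *)
Let vol_term_coercive v : mlow * fine (grad_norm2 M v) <= vol_term v v.
Proof.
have mw := measurable_wgrad HM v.
have mPhi : measurable_fun D (fun x => dot (wgrad D v x) (B x (wgrad D v x))).
  by apply: measurable_dot => //; exact: measurable_Bmap.
have mdot := measurable_dot mw mw.
have ml0 : 0 <= mlow by rewrite le_min invr_ge0 ltW.
have gradE : (\int[plane_leb]_(x in D) (dot (wgrad D v x) (wgrad D v x))%:E)%E
  = grad_norm2 M v by [].
have intZ k : 0 <= k ->
    (\int[plane_leb]_(x in D) (k * dot (wgrad D v x) (wgrad D v x))%:E =
     k%:E * grad_norm2 M v)%E.
  move=> k0; rewrite -gradE -ge0_integralZl//.
  - exact/measurable_EFinP.
  - by move=> x _; rewrite lee_fin dot_ge0.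
have up : (\int[plane_leb]_(x in D) (dot (wgrad D v x) (B x (wgrad D v x)))%:E
    <= K%:E * grad_norm2 M v)%E.
  rewrite -intZ ?(ltW K0)//; apply: ge0_le_integral => //.
  - by move=> x _; rewrite lee_fin Bmap_ge0.
  - exact/measurable_EFinP.
  - by apply/measurable_EFinP; apply: measurable_funM => //; exact: measurable_cst.
  - move=> x _; rewrite lee_fin.
    rewrite -(@ler_pXn2r _ 2) ?nnegrE ?Bmap_ge0 ?mulr_ge0 ?dot_ge0 ?(ltW K0)//.
    rewrite exprMn [X in _ <= _ * X]expr2; exact: Bmap_bound.
have low : (mlow%:E * grad_norm2 M v <=
    \int[plane_leb]_(x in D) (dot (wgrad D v x) (B x (wgrad D v x)))%:E)%E.
  rewrite -intZ//; apply: ae_ge0_le_integral => //.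
  - by move=> x _; rewrite lee_fin mulr_ge0 ?dot_ge0.
  - by apply/measurable_EFinP; apply: measurable_funM => //; exact: measurable_cst.
  - by move=> x _; rewrite lee_fin Bmap_ge0.
  - exact/measurable_EFinP.
  - exists [set (0 : R * R)]; split; last first.
    + move=> x /= nx; apply: contrapT => x0; apply: nx => _; rewrite lee_fin.
      apply: Bmap_coercive => //; apply/eqP => /enorm_eq0; exact: x0.
    + exact: leb0.
    + rewrite (_ : [set 0] = [set 0] `*` [set 0]).
        by apply: measurableX; exact: measurable_set1.
      by apply/seteqP; split => [x ->|[x y] /= [-> ->]].
rewrite /vol_term (Rintegral_leb2E mD mPhi).
rewrite -lee_fin EFinM fineK ?grad_fin// fineK//.
rewrite ge0_fin_numE; last by apply: integral_ge0 => x _; rewrite lee_fin Bmap_ge0.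
apply: le_lt_trans up _; rewrite -(fineK (grad_fin v)) -EFinM; exact: ltry.
Qed.

(** The trace of a finite element function is bounded and the boundary has
    finite length. This keeps the energy finite: for an infinite one the real
    number [A_h] could not control it. *)
Let itr2_fin h v i : 0 < h <= hmax M -> Vh M h v -> itr2 v i \is a fin_num.
Proof.
move=> hh Vv; have [mv vB] := Vh_measurable_bounded HM hh Vv.
have [C CP] := trace_bounded mD (refdom_square HM) mv vB.
rewrite ge0_fin_numE//.
apply: (@le_lt_trans _ _ ((C ^+ 2)%:E *
    \int[mu]_(t in `[0%R, 1%R]) (speed i t)%:E)%E).
  rewrite -ge0_integralZl//; last 3 first.
  - by apply/measurable_EFinP; exact: msp.
  - by move=> t _; rewrite lee_fin speed_ge0.
  - by rewrite lee_fin sqr_ge0.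
  apply: ge0_le_integral => //.
  - by move=> t _; rewrite lee_fin.
  - by apply/measurable_EFinP; exact: mtr2.
  - apply/measurable_EFinP; apply: measurable_funM; first exact: measurable_cst.
    exact: msp.
  - move=> t _; rewrite -EFinM lee_fin /tr_density.
    apply: ler_wpM2r; first exact: speed_ge0.
    by rewrite -[leLHS]real_normK ?num_real// lerXn2r ?nnegrE//;
      apply: le_trans (CP (refarc i t)).
have := length_refarc_lty HM i.
rewrite -ge0_fin_numE; last by apply: integral_ge0 => t _; rewrite lee_fin speed_ge0.
by move=> /fineK <-; rewrite -EFinM ltry.
Qed.

(** The boundary terms of [A_h v v] of one arc, by the Cauchy-Schwarz and Young
    inequalities. *)
Let arc_coercive beta h d v i : 0 < h <= hmax M -> 0 < d -> Vh M h v ->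
  igt2 v i \is a fin_num ->
  (beta * h^-1 - (d * h)^-1) * fine (itr2 v i) - d * h * K ^+ 2 * fine (igt2 v i)
  <= penalty_term beta h v v i - flux_term v v i.
Proof.
move=> hh d0 Vv gfin; have h0 : 0 < h by case/andP: hh.
have tfin := itr2_fin i hh Vv.
have [mv _] := Vh_measurable_bounded HM hh Vv.
have mt := @mtr2 v i mv; have mg := @mgt2 v i; have mf := @flux_term_measurable v v i mv.
have it2 : mu.-integrable I01 (EFin \o tr_density v i).
  apply/integrableP; split; first exact/measurable_EFinP.
  rewrite (eq_integral (fun t => (tr_density v i t)%:E)); last first.
    by move=> t _; rewrite /= ger0_norm.
  by move: tfin; rewrite (ge0_fin_numE (itr2_ge0 v i)) => tfin; exact: tfin.
have ig2 : mu.-integrable I01 (EFin \o grad_density v i).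
  apply/integrableP; split; first exact/measurable_EFinP.
  rewrite (eq_integral (fun t => (grad_density v i t)%:E)); last first.
    by move=> t _; rewrite /= ger0_norm.
  by move: gfin; rewrite (ge0_fin_numE (igt2_ge0 v i)) => gfin; exact: gfin.
have if1 : mu.-integrable I01
    (EFin \o (fun t => flux v i t * tr_arc v i t * speed i t)).
  have := integrableZl m01 K (integrableD m01 ig2 it2).
  apply: le_integrable => //; first exact/measurable_EFinP.
  move=> t _; rewrite /= lee_fin [leRHS]ger0_norm; last first.
    by rewrite mulr_ge0 ?(ltW K0)// addr_ge0.
  rewrite -[leLHS]ger0_norm// -(@ler_pXn2r _ 2) ?nnegrE ?normr_ge0//; last first.
    by rewrite mulr_ge0 ?(ltW K0)// addr_ge0.
  rewrite normr_id real_normK ?num_real//; apply: le_trans (flux_term_sqr _ _ _ _) _.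
  rewrite exprMn; apply: ler_wpM2l; first exact: sqr_ge0.
  by have := grad_density_ge0 v i t; have := tr_density_ge0 v i t; nra.
have ib := integrableZl m01 (beta * h^-1) it2.
have penalty_termE : penalty_term beta h v v i = beta * h^-1 * fine (itr2 v i) - flux_term v v i.
  rewrite -(RintegralZl (beta * h^-1) m01 it2) -(RintegralB m01 ib if1).
  by apply: eq_Rintegral => t _; rewrite /tr_density; ring.
have := @Rintegral_Cauchy_Schwarz R _ _ mu _ _ _ _ K m01 (ltW K0) mf mg mt
  (fun t _ => grad_density_ge0 v i t) (fun t _ => tr_density_ge0 v i t) (fun t _ => flux_term_sqr v v i t).
rewrite -/(flux_term v v i) -/(igt2 v i) -/(itr2 v i) -(fineK gfin) -(fineK tfin) /=.
rewrite lee_fin => /(le_trans (ler_norm _)).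
have : 0 <= fine (igt2 v i) by rewrite fine_ge0.
have : 0 <= fine (itr2 v i) by rewrite fine_ge0.
rewrite penalty_termE; move: (flux_term v v i) (fine (itr2 v i)) (fine (igt2 v i)) => T x y x0 y0 Txy.
have [p [p0 pE]] : exists p, 0 <= p /\ p ^+ 2 = x.
  by exists (Num.sqrt x); rewrite sqrtr_ge0 sqr_sqrtr.
have [q [q0 qE]] : exists q, 0 <= q /\ q ^+ 2 = y.
  by exists (Num.sqrt y); rewrite sqrtr_ge0 sqr_sqrtr.
move: Txy; rewrite -pE -qE !sqrtr_sqr (ger0_norm p0) (ger0_norm q0) => Tpq.
have dh0 : 0 < d * h by rewrite mulr_gt0.
have := young_mul (K * q) p dh0; rewrite /young => yKqp.
have -> : d * h * K ^+ 2 * q ^+ 2 = d * h * (K * q * (K * q)) by ring.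
have -> : (beta * h^-1 - (d * h)^-1) * p ^+ 2 =
  beta * h^-1 * p ^+ 2 - (d * h)^-1 * (p * p) by ring.
have : K * (q * p) = K * q * p by ring.
by lra.
Qed.

Theorem form_coercive : exists2 beta0 : R, 0 < beta0 &
  forall beta, beta0 <= beta -> exists2 C : R, 0 < C &
    forall h v, 0 < h <= hmax M -> Vh M h v ->
      (energy M h v ^+ 2 <= C%:E * (A_h M beta h v v)%:E)%E.
Proof.
have [cI cI0 inv] := stab_inverse HM.
pose m := Num.min mlow 1.
have m0 : 0 < m by rewrite /m /mlow !lt_min invr_gt0 g0 ltr01.
have [m1 m2] : m <= mlow /\ m <= 1.
  by split; rewrite /m ge_min lexx ?orbT.
(* Young's inequality with this weight and the inverse inequality bound the
   consistency terms by half of the gradient and stabilization terms. *)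
pose d := m / (2 * K ^+ 2 * cI).
have d0 : 0 < d by rewrite divr_gt0// !mulr_gt0// exprn_gt0.
exists (d^-1 + 1); first by rewrite addr_gt0// invr_gt0.
move=> beta hb; exists ((1 + cI) * (2 / m) + 1).
  by rewrite addr_gt0// mulr_gt0 ?divr_gt0// addr_gt0.
move=> h v hh Vv; have h0 : 0 < h by case/andP: hh.
have [_ _ proj] : [/\ _, _ & _] := (interp_scott_zhang HM).1 _ hh.
have := inv h v hh Vv.
rewrite /energy sqr_sqrte ?energy2_ge0// energy2E A_hE (proj _ Vv).
change (bd_grad_norm2 M v) with (\sum_i igt2 v i)%E.
set s := s_h M h v v; have s0 : 0 <= s by apply: s_h_ge0 HM _ _ _.
rewrite -(fineK (grad_fin v)) -EFinD -EFinM.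
have : 0 <= fine (grad_norm2 M v) by rewrite fine_ge0.
have := vol_term_coercive v; move: (fine (grad_norm2 M v)) => G volG G0 bdle.
have gfin i : igt2 v i \is a fin_num.
  rewrite ge0_fin_numE//; have := scaled_le_sum i h0 (igt2_ge0 v).
  move=> /le_trans/(_ bdle); case: (igt2 v i) (igt2_ge0 v i) => [r _ _||//].
    exact: ltry.
  by rewrite gt0_muley ?lte_fin.
have sum_fine (F : 'I_(narcs M) -> \bar R) : (forall i, F i \is a fin_num) ->
    (\sum_i F i = (\sum_i fine (F i))%:E)%E.
  by move=> Ff; rewrite -sumEFin; apply: eq_bigr => i _; rewrite fineK.
have tfin i := itr2_fin i hh Vv.
move: bdle; rewrite !sum_fine// -!EFinM -!EFinD !lee_fin.
have : (beta * h^-1 - (d * h)^-1) * (\sum_i fine (itr2 v i))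
    - d * h * K ^+ 2 * (\sum_i fine (igt2 v i))
    <= \sum_i penalty_term beta h v v i - \sum_i flux_term v v i.
  rewrite !mulr_sumr -!sumrB; apply: ler_sum => i _.
  exact: arc_coercive.
have : 0 <= \sum_i fine (itr2 v i) by apply: sumr_ge0 => i _; rewrite fine_ge0.
have : 0 <= \sum_i fine (igt2 v i) by apply: sumr_ge0 => i _; rewrite fine_ge0.
move: (\sum_i fine (igt2 v i)) (\sum_i fine (itr2 v i)) => b t b0 t0.
move: (\sum_i flux_term v v i) (\sum_i penalty_term beta h v v i) => S1 S2 S12 bdle.
have dK : d * h * K ^+ 2 * b <= m / 2 * (G + s).
  have -> : d * h * K ^+ 2 * b = m / (2 * cI) * (h * b).
    by rewrite /d; field; rewrite !gt_eqF.
  have -> : m / 2 * (G + s) = m / (2 * cI) * (cI * (G + s)).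
    by field; rewrite gt_eqF.
  by apply: ler_wpM2l => //; rewrite divr_ge0 ?mulr_ge0 ?ltW.
pose T := h^-1 * t.
have T_ge0 : 0 <= T by rewrite mulr_ge0// invr_ge0 ltW.
have bt : (beta * h^-1 - (d * h)^-1) * t = (beta - d^-1) * T.
  by rewrite /T; field; rewrite !gt_eqF.
have bT : T <= (beta - d^-1) * T.
  by rewrite ler_peMl// lerBrDr addrC.
have A1 : m / 2 * (G + s) + T <= vol_term v v - S1 + S2 + s.
  have mG : m * G <= mlow * G by exact: ler_wpM2r.
  have ms : m * s <= s by rewrite ler_piMl.
  by rewrite bt in S12; lra.
apply: (@le_trans _ _ ((1 + cI) * (G + s) + T)); first by rewrite -/T; lra.
have C0 : 0 <= (1 + cI) * (2 / m) + 1.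
  by rewrite addr_ge0// mulr_ge0 ?divr_ge0 ?addr_ge0 ?ltW.
apply: le_trans (ler_wpM2l C0 A1).
have -> : ((1 + cI) * (2 / m) + 1) * (m / 2 * (G + s) + T) =
  (1 + cI) * (G + s) + T + (m / 2 * (G + s) + (1 + cI) * (2 / m) * T).
  by field; rewrite gt_eqF.
have c1 : 0 <= 1 + cI by rewrite addr_ge0// ltW.
have mm : 0 <= m / 2 by rewrite divr_ge0// ltW.
have mi : 0 <= 2 / m by rewrite divr_ge0// ltW.
have Gs : 0 <= G + s by exact: addr_ge0.
rewrite lerDl; apply: addr_ge0; first exact: mulr_ge0.
by apply: mulr_ge0 => //; exact: mulr_ge0.
Qed.

End Estimates.

Theorem mainTheorem2 (R : realType) (M : cutfem R) (omega_c : R)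
    (HM : cutfem_setting M omega_c) :
  (forall beta eps : R, 0 < beta -> 0 < eps ->
     exists2 C : R, 0 < C &
       forall (h : R) (v w : R * R -> R), 0 < h <= hmax M ->
         Hs_plus_Vh M h (3 / 2 + eps) v -> Hs_plus_Vh M h (3 / 2 + eps) w ->
         ((A_h M beta h v w)%:E <= C%:E * energy M h v * energy M h w)%E) /\
  (exists2 beta0 : R, 0 < beta0 &
     forall beta : R, beta0 <= beta ->
       exists2 C : R, 0 < C &
         forall (h : R) (v : R * R -> R), 0 < h <= hmax M -> Vh M h v ->
           (energy M h v ^+ 2 <= C%:E * (A_h M beta h v v)%:E)%E).
Proof.
split; last exact: form_coercive HM.
move=> beta eps b0 eps0; have [C C0 CP] := form_continuous HM b0.
have s0 : 0 <= 3 / 2 + eps by rewrite addr_ge0// ltW.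
exists C => // h v w hh Hv Hw; apply: CP; first by case/andP: hh.
  exact (@Hs_plus_Vh_measurable _ _ _ HM _ _ _ hh s0 Hv).
exact (@Hs_plus_Vh_measurable _ _ _ HM _ _ _ hh s0 Hw).
Qed.
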